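(* Let $(R,\mathfrak m)$ be a local ring, $M$ a finitely generated $R$-module of dimension $d$ and $I$ a proper ideal of $R$. If $H_I^d(M)\neq 0$ and $d\le 2$, then $H_I^d(M)$ is co-Cohen-Macaulay.
   Context: Local ring means commutative Noetherian local ring. $H^d_I(M)$ is the $d$-th local cohomology module of $M$ with respect to $I$ (an Artinian $R$-module, since $d=\dim M$). Let $(A,\mathfrak n)$ be a commutative quasi-local ring and $X$ an Artinian $A$-module. The N.dimension (Noetherian dimension) $\mathrm{N.dim}_A(X)$ is defined inductively: $\mathrm{N.dim}_A(X)=-1$ when $X=0$; for an integer $r\ge 0$, put $\mathrm{N.dim}_A(X)=r$ when $\mathrm{N.dim}_A(X)<r$ is false and for every ascending chain $X_0\subseteq X_1\subseteq X_2\subseteq\cdots$ of submodules of $X$ there exists an integer $n$ such that $\mathrm{N.dim}_A(X_{m+1}/X_m)<r$ for all $m\ge n$. A sequence $x_1,\ldots,x_n\in\mathfrak n$ is $X$-coregular if multiplication by $x_i$ on $0:_X(x_1,\ldots,x_{i-1})$ is surjective for $i=1,\ldots,n$, where $0:_X(y_1,\ldots,y_k)=\{u\in X: y_1u=\cdots=y_ku=0\}$ (equal to $X$ when $k=0$). The width $\mathrm{width}_A(X)$ is the length of a maximal $X$-coregular sequence in $\mathfrak n$. $X$ is co-Cohen-Macaulay if $\mathrm{width}_A(X)=\mathrm{N.dim}_A(X)$. *)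

(* Defs.v *)
From HB Require Import structures.
From mathcomp Require Import all_boot all_algebra.
From mathcomp Require Import generic_quotient ring_quotient.
From mathcomp Require Import boolp.

Set Implicit Arguments.
Unset Strict Implicit.
Unset Printing Implicit Defensive.

Import GRing.Theory.
Local Open Scope ring_scope.
Local Open Scope quotient_scope.

(* Ideals ([idealr], proper by definition) and submodules ([submodClosed]) are
   boolean predicates.  With the classical axioms of [boolp] every predicate is
   boolean, so these are all the proper ideals and all the submodules. *)

Section Submodules.
Variables (R : pzRingType) (V : lmodType R).

Definition submod (B : submodClosed V) : Type := {x : V | x \in B}.

Section SubmodInstances.
Variable B : submodClosed V.
HB.instance Definition _ := SubChoice.on (submod B).
HB.instance Definition _ := [SubChoice_isSubLmodule of submod B by <:].
End SubmodInstances.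

Definition zero_pred : {pred V} := [pred x | x == 0].

Lemma zero_pred_closed : submod_closed zero_pred.
Proof.
split=> [|a x y]; rewrite !inE // => /eqP-> /eqP->.
by rewrite scaler0 addr0.
Qed.
HB.instance Definition _ :=
  GRing.isSubmodClosed.Build R V zero_pred zero_pred_closed.
Definition zero_submod : submodClosed V :=
  GRing.SubmodClosed.clone R V zero_pred _.

(* The submodule A of V, restricted to the submodule B. *)
Definition trace_pred (B A : submodClosed V) : {pred submod B} :=
  [pred u | \val u \in A].
Arguments trace_pred : clear implicits.

Section TraceInstance.
Variables B A : submodClosed V.
Lemma trace_pred_closed : submod_closed (trace_pred B A).
Proof.
split=> [|a x y]; rewrite !inE; first exact: rpred0.
by move=> xA yA; rewrite linearP rpredD ?rpredZ.
Qed.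
HB.instance Definition _ :=
  GRing.isSubmodClosed.Build R (submod B) (trace_pred B A) trace_pred_closed.
Definition trace_submod : submodClosed (submod B) :=
  GRing.SubmodClosed.clone R (submod B) (trace_pred B A) _.
End TraceInstance.

End Submodules.

Section LinearMaps.
Variables (R : pzRingType) (V W : lmodType R) (f : {linear V -> W}).

Definition kernel_pred : {pred V} := [pred x | f x == 0].
Definition image_pred : {pred W} := [pred y | `[< exists x, f x = y >]].

Lemma kernel_pred_closed : submod_closed kernel_pred.
Proof.
split=> [|a x y]; rewrite !inE ?linear0 // => /eqP fx /eqP fy.
by rewrite linearP fx fy scaler0 addr0.
Qed.
HB.instance Definition _ :=
  GRing.isSubmodClosed.Build R V kernel_pred kernel_pred_closed.
Definition kernel : submodClosed V :=
  GRing.SubmodClosed.clone R V kernel_pred _.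

Lemma image_pred_closed : submod_closed image_pred.
Proof.
split=> [|a x y]; rewrite !inE.
  by apply/asboolP; exists 0; rewrite linear0.
move=> /asboolP[u <-] /asboolP[v <-]; apply/asboolP; exists (a *: u + v).
by rewrite linearP.
Qed.
HB.instance Definition _ :=
  GRing.isSubmodClosed.Build R W image_pred image_pred_closed.
Definition image_of : submodClosed W :=
  GRing.SubmodClosed.clone R W image_pred _.
End LinearMaps.

(* The library's quotient group V / A ([Quotient.quot]), with its R-module
   structure added. *)
Section QuotientModule.
Variables (R : pzRingType) (V : lmodType R) (A : submodClosed V).

(* [submodClosed] is stated for semimodules: closure under opposites, automatic
   over a ring, has to be added. *)
Definition submod_pred : {pred V} := [pred x | x \in A].
HB.instance Definition _ := GRing.isZmodClosed.Build V submod_pred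
  (GRing.submod_closedB (GRing.submodClosedP A)).
Definition zmod_of_submod : zmodClosed V :=
  GRing.ZmodClosed.clone V submod_pred _.

Definition quotmod : Type := Quotient.quot zmod_of_submod.
HB.instance Definition _ := GRing.Zmodule.on quotmod.

Definition quotmod_pi (x : V) : quotmod :=
  \pi_(Quotient.quot zmod_of_submod) x.

Lemma quotmod_repr (q : quotmod) :
  quotmod_pi (repr (q : Quotient.quot zmod_of_submod)) = q.
Proof. exact: reprK. Qed.

Definition quotmod_scale (a : R) (q : quotmod) : quotmod :=
  quotmod_pi (a *: repr (q : Quotient.quot zmod_of_submod)).

Lemma quotmod_piE (x y : V) :
  (x - y \in A) = (quotmod_pi x == quotmod_pi y).
Proof.
have -> : (x - y \in A) = (x - y \in zmod_of_submod) by rewrite inE.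
exact: Quotient.idealrBE.
Qed.

Lemma quotmod_scale_pi a (x : V) :
  quotmod_scale a (quotmod_pi x) = quotmod_pi (a *: x).
Proof.
apply/eqP; rewrite /quotmod_scale -quotmod_piE -scalerBr rpredZ //.
by rewrite quotmod_piE quotmod_repr.
Qed.

Lemma quotmod_piD (x y : V) :
  quotmod_pi x + quotmod_pi y = quotmod_pi (x + y).
Proof. exact/esym/Quotient.pi_add. Qed.

Lemma quotmod_scaleA a b q :
  quotmod_scale a (quotmod_scale b q) = quotmod_scale (a * b) q.
Proof. by rewrite -[q]quotmod_repr !quotmod_scale_pi scalerA. Qed.

Lemma quotmod_scale1 : left_id 1 quotmod_scale.
Proof. by move=> q; rewrite -[q]quotmod_repr quotmod_scale_pi scale1r. Qed.

Lemma quotmod_scaleDr : right_distributive quotmod_scale +%R.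
Proof.
move=> a p q; rewrite -[p]quotmod_repr -[q]quotmod_repr.
by rewrite quotmod_piD !quotmod_scale_pi quotmod_piD scalerDr.
Qed.

Lemma quotmod_scaleDl q : {morph quotmod_scale^~ q : a b / a + b}.
Proof.
move=> a b; rewrite -[q]quotmod_repr.
by rewrite !quotmod_scale_pi quotmod_piD scalerDl.
Qed.

HB.instance Definition _ := GRing.Zmodule_isLmodule.Build R quotmod
  quotmod_scaleA quotmod_scale1 quotmod_scaleDr quotmod_scaleDl.

Lemma quotmod_pi_linear : linear quotmod_pi.
Proof. by move=> a x y; rewrite -quotmod_piD -quotmod_scale_pi. Qed.
HB.instance Definition _ :=
  GRing.isLinear.Build R V quotmod *:%R quotmod_pi quotmod_pi_linear.
End QuotientModule.

(* B / A for submodules A <= B of V (in general, B / (A :&: B)). *)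
Definition subquot (R : pzRingType) (V : lmodType R) (B A : submodClosed V) :
  lmodType R := quotmod (trace_submod B A).

Section RingsAndModules.
Variable R : comNzRingType.

Definition is_zero_module (X : lmodType R) : Prop := forall x : X, x = 0.

Definition finitely_generated (X : lmodType R) : Prop :=
  exists (n : nat) (g : 'I_n -> X),
    forall x, exists c : 'I_n -> R, x = \sum_i c i *: g i.

Definition noetherian_ring : Prop :=
  forall J : idealr R, exists (n : nat) (g : 'I_n -> R),
    (forall i, g i \in J) /\
    forall x, x \in J -> exists c : 'I_n -> R, x = \sum_i c i * g i.

Definition maximal_ideal (J : idealr R) : Prop :=
  forall K : idealr R, {subset J <= K} -> K =i J.

Definition local_ring (m : idealr R) : Prop :=
  [/\ noetherian_ring, maximal_ideal m
    & forall J : idealr R, maximal_ideal J -> J =i m].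

(* A chain p 0 < p 1 < ... < p l of primes containing the annihilator of X. *)
Definition prime_chain (X : lmodType R) (l : nat)
    (p : nat -> prime_idealr R) : Prop :=
  (forall a, (forall x : X, a *: x = 0) -> a \in p 0%N) /\
  (forall i, (i < l)%N ->
     {subset p i <= p i.+1} /\ ~ {subset p i.+1 <= p i}).

(* dim X = d, the Krull dimension of R / Ann X. *)
Definition krull_dim (X : lmodType R) (d : nat) : Prop :=
  (exists p, prime_chain X d p) /\
  (forall l p, prime_chain X l p -> (l <= d)%N).

Definition artinian (X : lmodType R) : Prop :=
  forall C : nat -> submodClosed X, (forall i, {subset C i.+1 <= C i}) ->
  exists n, forall k, (n <= k)%N -> C k =i C n.

End RingsAndModules.

Section LocalCohomology.
Variables (R : comNzRingType) (I : idealr R).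

(* r \in I ^ n, a finite sum of products of n elements of I (I ^ 0 = R). *)
Definition in_ideal_pow (n : nat) (r : R) : Prop :=
  exists (k : nat) (c : 'I_k -> R) (a : 'I_k -> 'I_n -> R),
    (forall i j, a i j \in I) /\ r = \sum_i c i * \prod_j a i j.

Lemma in_ideal_powW n k r : (n <= k)%N -> in_ideal_pow k r -> in_ideal_pow n r.
Proof.
move=> nk [l [c [a [aI ->]]]].
exists l, (fun i => c i * \prod_(j < k | ~~ (j < n)%N) a i j),
  (fun i j => a i (widen_ord nk j)); split=> // .
apply: eq_bigr => i _; rewrite -mulrA; congr (_ * _).
rewrite (bigID (fun j : 'I_k => (j < n)%N)) /= mulrC; congr (_ * _).
by rewrite (big_ord_narrow nk).
Qed.

Definition torsion_pred (X : lmodType R) : {pred X} :=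
  [pred x | `[< exists n, forall r, in_ideal_pow n r -> r *: x = 0 >]].

Lemma torsion_pred_closed (X : lmodType R) : submod_closed (@torsion_pred X).
Proof.
split=> [|a x y]; rewrite !inE.
  by apply/asboolP; exists 0%N => r _; rewrite scaler0.
move=> /asboolP[n nx] /asboolP[k ky]; apply/asboolP; exists (maxn n k) => r rI.
rewrite scalerDr scalerA mulrC -scalerA nx ?ky ?scaler0 ?addr0 //.
  exact: in_ideal_powW (leq_maxr _ _) rI.
exact: in_ideal_powW (leq_maxl _ _) rI.
Qed.
HB.instance Definition _ (X : lmodType R) :=
  GRing.isSubmodClosed.Build R X (@torsion_pred X) (@torsion_pred_closed X).
Definition torsion (X : lmodType R) : submodClosed X :=
  GRing.SubmodClosed.clone R X (@torsion_pred X) _.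

Lemma torsion_linear (X Y : lmodType R) (f : {linear X -> Y}) (x : X) :
  x \in torsion X -> f x \in torsion Y.
Proof.
rewrite !inE => /asboolP[n nx]; apply/asboolP; exists n => r /nx rx.
by rewrite -linearZ rx linear0.
Qed.

(* The I-torsion functor Gamma_I, on modules and on linear maps. *)
Definition Gamma (X : lmodType R) : lmodType R := submod (torsion X).

Definition Gamma_map (X Y : lmodType R) (f : {linear X -> Y})
  (u : Gamma X) : Gamma Y := Sub (f (\val u)) (torsion_linear f (valP u)).

Lemma Gamma_map_linear (X Y : lmodType R) (f : {linear X -> Y}) :
  linear (Gamma_map f).
Proof. by move=> a u v; apply: val_inj; rewrite linearP !SubK !linearP. Qed.
HB.instance Definition _ (X Y : lmodType R) (f : {linear X -> Y}) :=
  GRing.isLinear.Build R (Gamma X) (Gamma Y) *:%R (Gamma_map f)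
    (Gamma_map_linear f).

End LocalCohomology.

Section Cohomology.
Variables (R : comNzRingType) (C : nat -> lmodType R)
  (d : forall i, {linear C i -> C i.+1}).

Definition coboundaries (i : nat) : submodClosed (C i) :=
  match i return submodClosed (C i) with
  | 0 => zero_submod (C 0%N)
  | j.+1 => image_of (d j)
  end.

Definition cohomology (i : nat) : lmodType R :=
  subquot (kernel (d i)) (coboundaries i).
End Cohomology.

Definition injective_module (R : comNzRingType) (E : lmodType R) : Prop :=
  forall (A B : lmodType R) (i : {linear A -> B}) (f : {linear A -> E}),
  injective i -> exists g : {linear B -> E}, forall a, g (i a) = f a.

Record injective_resolution (R : comNzRingType) (M : lmodType R) := {
  res_mod : nat -> lmodType R;
  res_d : forall i, {linear res_mod i -> res_mod i.+1};
  res_aug : {linear M -> res_mod 0%N};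
  res_injective : forall i, injective_module (res_mod i);
  res_aug_inj : injective res_aug;
  res_exact0 : kernel (res_d 0%N) =i image_of res_aug;
  res_exactS : forall i, kernel (res_d i.+1) =i image_of (res_d i)
}.

(* H^i_I(M), the i-th right derived functor of Gamma_I at M: the cohomology of
   Gamma_I(E) for an injective resolution E of M.  It does not depend on E up
   to isomorphism. *)
Definition local_cohomology (R : comNzRingType) (I : idealr R) (M : lmodType R)
    (E : injective_resolution M) (i : nat) : lmodType R :=
  @cohomology R (fun j => Gamma I (res_mod E j))
    (fun j => Gamma_map (I := I) (res_d E j)) i.

Section CoCohenMacaulay.
Variable R : comNzRingType.

Definition chain_condition (P : lmodType R -> Prop) (X : lmodType R) : Prop :=
  forall C : nat -> submodClosed X, (forall i, {subset C i <= C i.+1}) ->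
  exists n, forall k, (n <= k)%N -> P (subquot (C k.+1) (C k)).

(* N.dim X < r.  For r = 0 this is N.dim X = -1, that is, X = 0. *)
Fixpoint Ndim_lt (r : nat) (X : lmodType R) : Prop :=
  match r with
  | 0 => is_zero_module X
  | s.+1 => Ndim_lt s X \/ (~ Ndim_lt s X /\ chain_condition (Ndim_lt s) X)
  end.

(* N.dim X = r, for r >= 0. *)
Definition Ndim_eq (X : lmodType R) (r : nat) : Prop :=
  ~ Ndim_lt r X /\ chain_condition (Ndim_lt r) X.

Definition annihilated (X : lmodType R) (s : seq R) (u : X) : Prop :=
  forall y, y \in s -> y *: u = 0.

Definition coregular (m : idealr R) (X : lmodType R) (s : seq R) : Prop :=
  {subset s <= m} /\
  forall i, (i < size s)%N -> forall u : X, annihilated (take i s) u ->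
    exists2 v : X, annihilated (take i s) v & s`_i *: v = u.

Definition maximal_coregular (m : idealr R) (X : lmodType R) (s : seq R) :
  Prop := coregular m X s /\ forall x, ~ coregular m X (rcons s x).

(* Maximal coregular sequences exist, and they all have length n. *)
Definition width_eq (m : idealr R) (X : lmodType R) (n : nat) : Prop :=
  (exists s, maximal_coregular m X s) /\
  (forall s, maximal_coregular m X s -> size s = n).

(* The notion is defined for Artinian modules only, hence the first clause.
   The zero module, of N.dimension -1 and without maximal coregular sequence,
   is not co-Cohen-Macaulay. *)
Definition co_Cohen_Macaulay (m : idealr R) (X : lmodType R) : Prop :=
  artinian X /\ exists n, width_eq m X n /\ Ndim_eq X n.

End CoCohenMacaulay.

(* Main.v *)
Require Import Defs.
From HB Require Import structures.
From mathcomp Require Import all_boot all_algebra.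
From mathcomp Require Import ring_quotient generic_quotient boolp ring.

(** Write H for the top local cohomology module of M with supports in I.

By prime avoidance there are d elements of I that generate, modulo Ann M, an ideal
with the same radical as I. Hence H can be computed with these elements, and it is a
direct limit: M itself if d = 0, the limit of the M / a^k M along multiplication by a
if d = 1, and the limit of the M / (a^k, b^k) M along multiplication by ab if d = 2
([presentation0], [presentation1], [presentation2]). This is a chase in the injective
resolution, which rests on two facts: the torsion submodules of injective modules are
injective, so that they map onto their localizations ([res_div]); and Ann M annihilates
the cohomology ([annihilator_bounds]), so that a generator of I can be added to
the supports if a power of it lies in the ideal generated so far, modulo Ann M
([cohom_cons_surj], [cohom_cons_inj]).

The direct limits show that H is Artinian of N.dimension at most d. Noetherian dimension
is a deviation of the preorder of submodules ([Ndim_ltE]). A submodule of a direct limit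
of copies of a module along multiplication by b is determined by a decreasing sequence of
submodules of a quotient modulo b ([fine_tower]), and a submodule of an a-torsion module
by a decreasing sequence of submodules of (0 : a) ([fine_torsion]). In a preorder with
descending chain condition, passing to decreasing sequences preserves this condition and
raises the deviation by at most one ([dev_seq]). After d steps one is left with a
quotient of M of finite length.

The direct limits also show that parameters of M are coregular on H. If x is a parameter,
then H / x H is the local cohomology of M / x M in degree d, above its dimension, so it
vanishes ([chains_lt1_pow]). If d = 2, then (0 :_H x) is, up to modules of dimension at
most 1, a quotient of the first local cohomology of M / x M, on which the next parameter y
acts surjectively for the same reason ([presentation2_surj2]).

A coregular sequence on a nonzero Artinian module is not longer than the N.dimension
([coregular_dev]). It remains to extend an arbitrary coregular sequence of length less
than d. The only case that is not covered by the parameters is a sequence of one element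
z with d = 2. Here (0 : x) / m (0 : x) and (0 : z) / m (0 : z) are isomorphic ([exchange]),
and the former vanishes, so (0 : z) = m (0 : z). By a weak form of secondary
representation and prime avoidance, some element of m then acts surjectively on the
Artinian module (0 : z) ([surj_exists]). Thus all maximal coregular sequences have length
d, and d is the N.dimension of H. *)

Set Implicit Arguments.
Unset Strict Implicit.
Unset Printing Implicit Defensive.

Import GRing.Theory.
Local Open Scope ring_scope.

(** * Deviation of preorders *)

Record preorder (T : Type) (le : T -> T -> Prop) : Prop := Preorder {
  pre_refl : forall x, le x x;
  pre_trans : forall y x z, le x y -> le y z -> le x z }.

Definition dcc (T : Type) (le : T -> T -> Prop) (D : T -> Prop) : Prop :=
  forall c : nat -> T, (forall i, D (c i)) -> (forall i, le (c i.+1) (c i)) ->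
  exists n, forall k, (n <= k)%N -> le (c n) (c k).

(** The dual of the Krull dimension of a preorder, shifted by one; on the
submodules of X it is the condition N.dim X < r. *)
Fixpoint dev_lt (T : Type) (le : T -> T -> Prop) (r : nat) (D : T -> Prop) :
    Prop :=
  match r with
  | 0 => forall a b, D a -> D b -> le a b -> le b a
  | s.+1 => forall c : nat -> T,
      (forall i, D (c i)) -> (forall i, le (c i) (c i.+1)) ->
      exists n, forall k, (n <= k)%N ->
        dev_lt le s (fun t => [/\ D t, le (c k) t & le t (c k.+1)])
  end.

Section OnePreorder.
Variables (T : Type) (le : T -> T -> Prop).
Hypothesis leT : preorder le.

Lemma chain_up (c : nat -> T) :
  (forall i, le (c i) (c i.+1)) -> forall i j, (i <= j)%N -> le (c i) (c j).
Proof.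
move=> cS i j /subnK <-; elim: (j - i)%N => [|k IHk]; first exact: pre_refl.
by rewrite addSn; apply: (pre_trans leT) IHk _.
Qed.

Lemma chain_down (c : nat -> T) :
  (forall i, le (c i.+1) (c i)) -> forall i j, (i <= j)%N -> le (c j) (c i).
Proof.
move=> cS i j /subnK <-; elim: (j - i)%N => [|k IHk]; first exact: pre_refl.
by rewrite addSn; apply: (pre_trans leT) IHk.
Qed.

Lemma dcc_sub (D D' : T -> Prop) :
  (forall t, D t -> D' t) -> dcc le D' -> dcc le D.
Proof. by move=> DD' D'd c cD; apply: D'd => i; apply: DD'. Qed.

End OnePreorder.

(** Both finiteness conditions pass from the target to the source of a strictly
monotone map: this is how a lattice of submodules is controlled, by a map
to a preorder that is already known. *)
Section StrictlyMonotone.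
Variables (T T' : Type) (le : T -> T -> Prop) (le' : T' -> T' -> Prop).
Variable f : T -> T'.

Definition strict_on (D : T -> Prop) : Prop :=
  (forall a b, D a -> D b -> le a b -> le' (f a) (f b)) /\
  (forall a b, D a -> D b -> le a b -> le' (f b) (f a) -> le b a).

Lemma dcc_strict (D : T -> Prop) (D' : T' -> Prop) : preorder le ->
  (forall t, D t -> D' (f t)) -> strict_on D -> dcc le' D' -> dcc le D.
Proof.
move=> leT fD [fm fs] D'd c cD cS.
have [|i|n nP] := D'd (fun i => f (c i)); [by move=> i; apply: fD| exact: fm|].
exists n => k nk; apply: fs (cD _) (cD _) _ (nP k nk).
exact: (chain_down leT cS nk).
Qed.

Lemma dev_strict r (D : T -> Prop) (D' : T' -> Prop) :
  (forall t, D t -> D' (f t)) -> strict_on D -> dev_lt le' r D' -> dev_lt le r D.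
Proof.
elim: r D D' => [|r IHr] D D' fD [fm fs] /= D'd.
  by move=> a b Da Db ab; apply: fs => //; apply: D'd; auto.
move=> c cD cS.
have [|i|n nP] := D'd (fun i => f (c i)); [by move=> i; apply: fD| exact: fm|].
exists n => k nk; apply: IHr (nP k nk).
  by move=> t [Dt ct tc]; split; auto.
by split=> a b [Da _ _] [Db _ _]; auto.
Qed.

End StrictlyMonotone.

Lemma dev_sub T (le : T -> T -> Prop) r (D D' : T -> Prop) :
  (forall t, D t -> D' t) -> dev_lt le r D' -> dev_lt le r D.
Proof. by move=> DD'; apply: (@dev_strict _ _ _ _ id). Qed.

Lemma dev_ltW T (le : T -> T -> Prop) r (D : T -> Prop) :
  dev_lt le r D -> dev_lt le r.+1 D.
Proof.
by move=> DP c cD cS; exists 0%N => k _; apply: dev_sub DP => t [].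
Qed.

Definition le_prod T1 T2 (le1 : T1 -> T1 -> Prop) (le2 : T2 -> T2 -> Prop)
  (u v : T1 * T2) : Prop := le1 u.1 v.1 /\ le2 u.2 v.2.

Lemma dcc_prod T1 T2 (le1 : T1 -> T1 -> Prop) (le2 : T2 -> T2 -> Prop) D1 D2 :
  preorder le1 -> preorder le2 -> dcc le1 D1 -> dcc le2 D2 ->
  dcc (le_prod le1 le2) (fun u => D1 u.1 /\ D2 u.2).
Proof.
move=> p1 p2 d1 d2 c cD cS.
have [||n1 n1P] := d1 (fun i => (c i).1); first by move=> i; case: (cD i).
  by move=> i; case: (cS i).
have [||n2 n2P] := d2 (fun i => (c i).2); first by move=> i; case: (cD i).
  by move=> i; case: (cS i).
have cS1 i : le1 (c i.+1).1 (c i).1 by case: (cS i).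
have cS2 i : le2 (c i.+1).2 (c i).2 by case: (cS i).
exists (maxn n1 n2) => k; rewrite geq_max => /andP[k1 k2]; split.
  apply: (pre_trans p1) (n1P k k1).
  exact: (chain_down p1 cS1 (leq_maxl _ _)).
apply: (pre_trans p2) (n2P k k2).
exact: (chain_down p2 cS2 (leq_maxr _ _)).
Qed.

Lemma dev_prod T1 T2 (le1 : T1 -> T1 -> Prop) (le2 : T2 -> T2 -> Prop) r D1 D2 :
  dev_lt le1 r D1 -> dev_lt le2 r D2 ->
  dev_lt (le_prod le1 le2) r (fun u => D1 u.1 /\ D2 u.2).
Proof.
elim: r D1 D2 => [|r IHr] D1 D2 /= d1 d2.
  by move=> a b [a1 a2] [b1 b2] [ab1 ab2]; split; auto.
move=> c cD cS.
have [||n1 n1P] := d1 (fun i => (c i).1); first by move=> i; case: (cD i).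
  by move=> i; case: (cS i).
have [||n2 n2P] := d2 (fun i => (c i).2); first by move=> i; case: (cD i).
  by move=> i; case: (cS i).
exists (maxn n1 n2) => k; rewrite geq_max => /andP[k1 k2].
apply: dev_sub (IHr _ _ (n1P k k1) (n2P k k2)).
by move=> t [[t1 t2] [c1 c2] [c1' c2']].
Qed.

Section Sequences.
Variables (T : Type) (le : T -> T -> Prop).
Hypothesis leT : preorder le.

Definition le_seq (s t : nat -> T) : Prop := forall n, le (s n) (t n).

Definition decr_in (D : T -> Prop) (s : nat -> T) : Prop :=
  (forall n, D (s n)) /\ (forall n, le (s n.+1) (s n)).

(** In a descending chain of decreasing sequences c i, the diagonal c i i is
decreasing, so beyond some d all the terms c i n with i, n >= d are equivalent; the
finitely many columns n < d become stationary one by one. *)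
Lemma dcc_seq (D : T -> Prop) : dcc le D -> dcc le_seq (decr_in D).
Proof.
move=> Dd c cD cS.
have cSn n i : le (c i.+1 n) (c i n) by apply: cS.
have cn i n : le (c i n.+1) (c i n) by case: (cD i).
have [||d dP] := Dd (fun i => c i i); first by move=> i; case: (cD i).
  by move=> i; apply: (pre_trans leT) (cSn i.+1 i) (cn i i).
have tail i n : (d <= i)%N -> (d <= n)%N -> le (c d n) (c i n).
  move=> di dn; apply: (pre_trans leT) (_ : le (c d n) (c d d)) _.
    exact: (chain_down leT (cn d) dn).
  apply: (pre_trans leT) (dP (maxn i n) _) _; first by rewrite leq_max di.
  apply: (pre_trans leT) (chain_down leT (cSn _) (leq_maxl i n)) _.
  exact: (chain_down leT (cn i) (leq_maxr i n)).
have head N : exists e, (d <= e)%N /\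
    forall n k, (n < N)%N -> (e <= k)%N -> le (c e n) (c k n).
  elim: N => [|N [e [de eP]]]; first by exists d.
  have [||e' e'P] := Dd (fun i => c i N); [by move=> i; case: (cD i)|exact: cSn|].
  exists (maxn e e'); split=> [|n k]; first by rewrite leq_max de.
  rewrite ltnS geq_max leq_eqVlt => /orP[/eqP->|nN] /andP[ek e'k].
    apply: (pre_trans leT) (e'P k e'k).
    exact: (chain_down leT (cSn _) (leq_maxr _ _)).
  apply: (pre_trans leT) (eP n k nN ek).
  exact: (chain_down leT (cSn _) (leq_maxl _ _)).
have [e [de eP]] := head d.
exists e => k ek n; case: (ltnP n d) => [nd|dn]; first exact: eP.
apply: (pre_trans leT) (chain_down leT (cSn n) de) _.
exact: tail (leq_trans de ek) dn.
Qed.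

(** Splitting off the first N terms of a sequence bounds the deviation by that of D
and that of the tails. *)
Lemma dev_seq_tail r (D D' : T -> Prop) N : dev_lt le r D ->
  dev_lt le_seq r (decr_in D') ->
  dev_lt le_seq r (fun s => [/\ forall n, D (s n),
    forall n, le (s n.+1) (s n) & forall n, (N <= n)%N -> D' (s n)]).
Proof.
move=> dD dD'; elim: N => [|N IHN].
  by apply: dev_sub dD' => s [_ sS sD]; split=> // n; apply: sD.
apply: (@dev_strict _ _ _ (le_prod le le_seq) (fun s => (s 0%N, fun n => s n.+1)))
   (dev_prod dD IHN) => /=.
  by move=> s [sD sS sD']; split=> //; split=> // n nN; apply: sD'.
split=> a b _ _ ab /=; first by split=> [|n]; apply: ab.
by case=> ba0 baS [|n]; [exact: ba0|exact: baS].
Qed.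

(** A decreasing sequence in D is eventually constant by the descending chain
condition, so an ascending chain of such sequences has an ascending chain of
limits.  Between two consecutive sequences, the terms beyond some index lie
between the two limits, an interval of smaller deviation; the finitely many
terms before it form a point of a power of D. *)
Lemma dev_seq r (D : T -> Prop) :
  dcc le D -> dev_lt le r D -> dev_lt le_seq r.+1 (decr_in D).
Proof.
elim: r D => [|r IHr] D Dd dD.
  by apply: dev_ltW => a b [aD _] [bD _] ab n; apply: dD.
move=> c cD cS.
have cS' k n : le (c k n.+1) (c k n) by case: (cD k).
have /choice[N NP] k : exists n, forall j, (n <= j)%N -> le (c k n) (c k j).
  by apply: Dd; case: (cD k).
have lS k : le (c k (N k)) (c k.+1 (N k.+1)).
  apply: (pre_trans leT) (NP k (maxn (N k) (N k.+1)) (leq_maxl _ _)) _.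
  apply: (pre_trans leT) (cS k _) _.
  exact: (chain_down leT (cS' k.+1) (leq_maxr _ _)).
have [||n nP] := dD (fun k => c k (N k)) => //; first by move=> k; case: (cD k).
exists n => k nk.
apply: dev_sub (@dev_seq_tail _ D _ (maxn (N k) (N k.+1)) dD
  (IHr _ _ (nP k nk))); last by apply: dcc_sub Dd => t [].
move=> t [[tD tS] ct tc]; split=> // j; rewrite geq_max => /andP[kj kj'].
split=> //; first exact: (pre_trans leT) (NP k j kj) (ct j).
exact: (pre_trans leT) (tc j) (chain_down leT (cS' k.+1) kj').
Qed.

End Sequences.

(** * Submodules *)

Section MakeSubmodule.
Variables (R : pzRingType) (V : lmodType R).

Definition sub_closed (P : V -> Prop) : Prop :=
  P 0 /\ forall a x y, P x -> P y -> P (a *: x + y).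

Lemma sub_closedZ P a x : sub_closed P -> P x -> P (a *: x).
Proof. by case=> P0 PD Px; rewrite -[a *: x]addr0; apply: PD. Qed.
Lemma sub_closedD P x y : sub_closed P -> P x -> P y -> P (x + y).
Proof. by case=> P0 PD Px; rewrite -[x]scale1r; apply: PD. Qed.
Lemma sub_closedB P x y : sub_closed P -> P x -> P y -> P (x - y).
Proof. by case=> P0 PD Px Py; rewrite addrC -scaleN1r; apply: PD. Qed.

Definition sub_pred (P : V -> Prop) (hP : sub_closed P) : {pred V} :=
  [pred x | `[< P x >]].

Lemma sub_pred_closed P (hP : sub_closed P) : submod_closed (sub_pred hP).
Proof.
split=> [|a x y]; rewrite !inE; first by apply/asboolP; case: hP.
by move=> /asboolP Px /asboolP Py; apply/asboolP; case: hP => _; apply.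
Qed.
HB.instance Definition _ P (hP : sub_closed P) :=
  GRing.isSubmodClosed.Build R V (sub_pred hP) (sub_pred_closed hP).
Definition mkS P (hP : sub_closed P) : submodClosed V :=
  GRing.SubmodClosed.clone R V (sub_pred hP) _.

Lemma mkSP P (hP : sub_closed P) x : reflect (P x) (x \in mkS hP).
Proof. by rewrite inE; apply: asboolP. Qed.

Lemma submodB (A : submodClosed V) x y : x \in A -> y \in A -> x - y \in A.
Proof. by move=> xA yA; rewrite rpredD // -scaleN1r rpredZ. Qed.

Lemma submod_lin (A : submodClosed V) a x y :
  x \in A -> y \in A -> a *: x + y \in A.
Proof. by move=> xA yA; rewrite rpredD ?rpredZ. Qed.

Lemma submod_addr (A : submodClosed V) x y : x \in A -> (x + y \in A) = (y \in A).
Proof.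
move=> xA; apply/idP/idP => [xyA|yA]; last exact: rpredD.
by rewrite -[y](addKr x) rpredD // -scaleN1r rpredZ.
Qed.

Definition le_sub (A B : submodClosed V) : Prop := {subset A <= B}.

Lemma le_sub_pre : preorder le_sub.
Proof. by split=> [A x //|A B C AB BC x /AB/BC]. Qed.

End MakeSubmodule.
Arguments le_sub {R V} A B.
Arguments le_sub_pre {R V}.

(** * Noetherian dimension as a deviation *)

Section NdimDeviation.
Variable R : comNzRingType.

(** Taking preimages and images identifies the submodules of B / A with those
between A and B, so that intervals of submodules have the deviation of the
corresponding subquotients. *)
Section Subquotient.
Variables (V : lmodType R) (B A : submodClosed V).

Lemma pullback_closed (C : submodClosed (subquot B A)) :
  sub_closed (fun x : V => exists u : submod B,
    \val u = x /\ quotmod_pi (trace_submod B A) u \in C).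
Proof.
split=> [|a x y [u [<- uC]] [v [<- vC]]].
  by exists 0; rewrite !linear0 rpred0.
by exists (a *: u + v); rewrite !linearP; split=> //; apply: submod_lin.
Qed.
Definition pullback C := mkS (pullback_closed C).

Lemma pushforward_closed (N : submodClosed V) :
  sub_closed (fun q : subquot B A => exists u : submod B,
    \val u \in N /\ quotmod_pi (trace_submod B A) u = q).
Proof.
split=> [|a x y [u [uN <-]] [v [vN <-]]].
  by exists 0; rewrite !linear0 rpred0.
exists (a *: u + v); rewrite !linearP; split=> //; exact: submod_lin.
Qed.
Definition pushforward N := mkS (pushforward_closed N).

Lemma subquot_eq (u v : submod B) :
  quotmod_pi (trace_submod B A) u = quotmod_pi (trace_submod B A) v ->
  \val u - \val v \in A.
Proof. by move/eqP; rewrite -quotmod_piE inE linearB. Qed.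

Lemma subquot_repr (q : subquot B A) :
  exists u, quotmod_pi (trace_submod B A) u = q.
Proof. by exists (repr (q : quotmod (trace_submod B A))); apply: quotmod_repr. Qed.

Lemma pullback_strict : strict_on le_sub le_sub pullback (fun _ => True).
Proof.
split=> [C D _ _ CD x /mkSP[u [<- uC]]|C D _ _ CD DC q qD].
  by apply/mkSP; exists u; split=> //; apply: CD.
have [u uq] := subquot_repr q.
have /DC/mkSP[v [/val_inj -> ]] : \val u \in pullback D.
  by apply/mkSP; exists u; rewrite uq.
by rewrite uq.
Qed.

Lemma pullback_interval C : le_sub A B ->
  le_sub A (pullback C) /\ le_sub (pullback C) B.
Proof.
move=> AB; split=> x; last by case/mkSP=> u [<- _]; apply: (valP u).
move=> xA; apply/mkSP; exists (Sub x (AB _ xA) : submod B); split=> //.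
have -> : quotmod_pi (trace_submod B A) (Sub x (AB _ xA)) = 0.
  apply/eqP; rewrite -[0](linear0 (quotmod_pi (trace_submod B A))) -quotmod_piE.
  by rewrite subr0 inE.
exact: rpred0.
Qed.

Lemma pushforward_strict :
  strict_on le_sub le_sub pushforward (fun N => le_sub A N /\ le_sub N B).
Proof.
split=> [C D _ _ CD x /mkSP[u [uC <-]]|C D [AC _] [_ DB] CD DC x xD].
  by apply/mkSP; exists u; split=> //; apply: CD.
have /DC/mkSP[v [vC /subquot_eq/AC/=]] :
    quotmod_pi (trace_submod B A) (Sub x (DB _ xD)) \in pushforward D.
  by apply/mkSP; exists (Sub x (DB _ xD)).
by rewrite submod_addr // -scaleN1r => /(rpredZ (-1)); rewrite scalerA mulrNN mulr1 scale1r.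
Qed.

End Subquotient.

Lemma chain_condition_step r :
  (forall X : lmodType R,
     Ndim_lt r X <-> dev_lt le_sub r (fun _ : submodClosed X => True)) ->
  forall X : lmodType R, chain_condition (Ndim_lt r) X <->
    dev_lt le_sub r.+1 (fun _ : submodClosed X => True).
Proof.
move=> NE X; split=> H C.
  move=> _ CS; have [n nP] := H C CS; exists n => k nk.
  move/NE: (nP k nk); apply: dev_strict => //.
  split=> A B [_ ? ?] [_ ? ?]; first by apply: (pushforward_strict _ _).1.
  exact: (pushforward_strict _ _).2.
move=> CS; have [n nP] := H C (fun=> I) CS; exists n => k nk; apply/NE.
apply: dev_strict (pullback_strict _ _) (nP k nk) => D _.
by split=> //; case: (@pullback_interval _ (C k.+1) (C k) D (CS k)).
Qed.

(** By induction on r, through the identification of the submodules of C k.+1 / C k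
with the interval between C k and C k.+1. *)
Lemma Ndim_ltE r (X : lmodType R) :
  Ndim_lt r X <-> dev_lt le_sub r (fun _ : submodClosed X => True).
Proof.
elim: r X => [|r IHr] X.
  split=> [X0 A B _ _ _ x _ | X0 x].
    by rewrite (X0 x) rpred0.
  have full : sub_closed (fun _ : X => True) by split.
  have: x \in zero_submod X.
    have le0 : le_sub (zero_submod X) (mkS full) by move=> y _; apply/mkSP.
    by apply: (X0 _ _ I I le0); apply/mkSP.
  by rewrite inE => /eqP.
split; first by case=> [/IHr/dev_ltW//|[_ /(chain_condition_step IHr)]].
move/(chain_condition_step IHr)=> H.
by case: (pselect (Ndim_lt r X)) => ?; [left|right].
Qed.

Lemma Ndim_eqE r (X : lmodType R) : Ndim_eq X r <->
  ~ dev_lt le_sub r (fun _ : submodClosed X => True) /\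
  dev_lt le_sub r.+1 (fun _ : submodClosed X => True).
Proof.
have cE := chain_condition_step (@Ndim_ltE r) X.
have nE := Ndim_ltE r X; rewrite /Ndim_eq; tauto.
Qed.

Lemma artinianE (X : lmodType R) :
  dcc le_sub (fun _ : submodClosed X => True) -> artinian X.
Proof.
move=> H C CS; have [n nP] := H C (fun=> I) CS; exists n => k nk x.
apply/idP/idP; last exact: nP.
exact: (chain_down le_sub_pre CS nk).
Qed.

End NdimDeviation.

(** * Primes over an ideal *)

(** Noetherian induction in the form of maximal elements, by dependent choice. *)
Lemma maximal_exists (T : Type) (lt : T -> T -> Prop) (Q : T -> Prop) (x0 : T) :
  (forall c : nat -> T, (forall i, Q (c i)) -> ~ forall i, lt (c i) (c i.+1)) ->
  Q x0 -> exists x, Q x /\ forall y, Q y -> ~ lt x y.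
Proof.
move=> noc Qx0; apply: contrapT => nomax.
have step (x : {x | Q x}) : exists y : {x | Q x}, lt (sval x) (sval y).
  apply: contrapT => ny; apply: nomax; exists (sval x); split=> [|y Qy xy].
    exact: (svalP x).
  by apply: ny; exists (exist _ y Qy).
have [f fP] := choice step.
pose c i := iter i f (exist _ x0 Qx0).
by apply: (noc (fun i => sval (c i))) => i; [exact: (svalP (c i))|exact: fP].
Qed.

Section Ideals.
Variable R : comNzRingType.
Implicit Types (P c : R -> Prop) (ps : seq (R -> Prop)).

Definition ideal P : Prop :=
  P 0 /\ forall r x y, P x -> P y -> P (r * x + y).

Lemma idealM P r x : ideal P -> P x -> P (r * x).
Proof. by case=> P0 PD Px; rewrite -[r * x]addr0; apply: PD. Qed.

Lemma idealD P x y : ideal P -> P x -> P y -> P (x + y).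
Proof. by case=> P0 PD Px; rewrite -[x]mul1r; apply: PD. Qed.

Lemma idealB P x y : ideal P -> P x -> P y -> P (x - y).
Proof. by case=> P0 PD Px Py; rewrite addrC -mulN1r; apply: PD. Qed.

Lemma idealr_ideal (J : idealr R) : ideal (fun r => r \in J).
Proof.
split=> [|r x y xJ yJ]; first exact: rpred0.
by rewrite rpredD // idealMr.
Qed.

Definition prime_ideal P : Prop :=
  [/\ ideal P, ~ P 1 & forall u v, P (u * v) -> P u \/ P v].

Section Make.
Variables (P : R -> Prop) (hP : ideal P) (hP1 : ~ P 1).
Definition ideal_pred (_ : ideal P) (_ : ~ P 1) : {pred R} := [pred x | `[< P x >]].
Lemma ideal_pred_closed : idealr_closed (ideal_pred hP hP1).
Proof.
have [P0 PD] := hP; split; rewrite ?inE; first exact/asboolP.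
  exact/asboolP.
by move=> r x y /asboolP Px /asboolP Py; apply/asboolP; apply: PD.
Qed.
HB.instance Definition _ :=
  isIdealr.Build R (ideal_pred hP hP1) ideal_pred_closed.
Definition mk_ideal : idealr R := Idealr.clone R (ideal_pred hP hP1) _.
Lemma mk_idealP x : reflect (P x) (x \in mk_ideal).
Proof. by rewrite inE; apply: asboolP. Qed.
End Make.

Section MakePrime.
Variables (P : R -> Prop) (hP : prime_ideal P).
Definition prime_pred (_ : prime_ideal P) : {pred R} := [pred x | `[< P x >]].
Lemma prime_pred_closed : idealr_closed (prime_pred hP).
Proof.
have [[P0 PD] P1 PM] := hP; split; rewrite ?inE; first exact/asboolP.
  exact/asboolP.
by move=> r x y /asboolP Px /asboolP Py; apply/asboolP; apply: PD.
Qed.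
Lemma prime_pred_prime : prime_idealr_closed (prime_pred hP).
Proof.
have [_ _ PM] := hP; move=> u v; rewrite !inE => /asboolP/PM[]/asboolP-> //.
by rewrite orbT.
Qed.
HB.instance Definition _ :=
  isIdealr.Build R (prime_pred hP) prime_pred_closed.
HB.instance Definition _ :=
  isPrimeIdealrClosed.Build R (prime_pred hP) prime_pred_prime.
Definition mk_prime : prime_idealr R := PrimeIdealr.clone R (prime_pred hP) _.
Lemma mk_primeP x : reflect (P x) (x \in mk_prime).
Proof. by rewrite inE; apply: asboolP. Qed.
End MakePrime.

(** The ideals c + (a) and (c : a ^ oo). *)
Definition ideal_add c (a : R) : R -> Prop := fun r => exists u p, c u /\ r = u + p * a.
Definition ideal_sat c (a : R) : R -> Prop := fun r => exists t, c (a ^+ t * r).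

Lemma ideal_add_ideal c a : ideal c -> ideal (ideal_add c a).
Proof.
move=> cI; split; first by exists 0, 0; rewrite mul0r addr0; case: cI.
move=> r x y [u [p [cu ->]]] [v [q [cv ->]]]; exists (r * u + v), (r * p + q).
split; first by case: cI => _; apply.
by rewrite mulrDr mulrDl mulrA addrACA.
Qed.

Lemma ideal_addl c a r : c r -> ideal_add c a r.
Proof. by exists r, 0; rewrite mul0r addr0. Qed.

Lemma ideal_addr c a : ideal c -> ideal_add c a a.
Proof. by case=> c0 _; exists 0, 1; rewrite mul1r add0r. Qed.

Lemma ideal_sat_ideal c a : ideal c -> ideal (ideal_sat c a).
Proof.
move=> cI; split; first by exists 0%N; rewrite mulr0; case: cI.
move=> r x y [s cs] [t ct]; exists (s + t)%N.
rewrite mulrDr; apply: idealD => //.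
  have -> : a ^+ (s + t) * (r * x) = (a ^+ t * r) * (a ^+ s * x) by rewrite exprD; ring.
  exact: idealM.
by rewrite exprD -mulrA; apply: idealM.
Qed.

Lemma ideal_satl c a r : c r -> ideal_sat c a r.
Proof. by exists 0%N; rewrite mul1r. Qed.

Lemma ideal_satP c a r : ideal_sat c a (a * r) -> ideal_sat c a r.
Proof. by case=> t; rewrite mulrA -exprSr; exists t.+1. Qed.

Section Noetherian.
Hypothesis R_noeth : noetherian_ring R.

(** The union of an ascending chain of ideals is finitely generated, unless it
contains 1, in which case it is the ideal of the chain that contains 1. *)
Lemma ideal_acc (c : nat -> R -> Prop) : (forall i, ideal (c i)) ->
  (forall i r, c i r -> c i.+1 r) ->
  exists n, forall k r, c k r -> c n r.
Proof.
move=> cI cS.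
have cmon i j r : (i <= j)%N -> c i r -> c j r.
  move=> /subnK <-; elim: (j - i)%N => [//|k IHk] /IHk; exact: cS.
pose U r := exists n, c n r.
have UI : ideal U.
  split=> [|r x y [i cx] [j cy]]; first by exists 0%N; case: (cI 0%N).
  exists (maxn i j); apply: (cI _).2.
    exact: cmon (leq_maxl _ _) cx.
  exact: cmon (leq_maxr _ _) cy.
case: (pselect (U 1)) => [[n c1]|U1].
  by exists n => k r _; rewrite -[r]mulr1; apply: idealM.
have [l [g [gU gP]]] := R_noeth (mk_ideal UI U1).
have /choice[N NP] i : exists n, c n (g i) by apply/(mk_idealP UI U1)/gU.
exists (\max_i N i) => k r ckr.
have /gP[f ->] : r \in mk_ideal UI U1 by apply/mk_idealP; exists k.
apply: big_ind => [|x y|i _]; first by case: (cI (\max_i N i)).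
  exact: idealD.
by apply: idealM => //; apply: cmon (NP i); apply: leq_bigmax.
Qed.

Lemma ideal_maximal (Q : (R -> Prop) -> Prop) c : ideal c -> Q c ->
  exists2 e, ideal e /\ Q e &
    forall e', ideal e' -> Q e' -> (forall r, e r -> e' r) -> forall r, e' r -> e r.
Proof.
move=> cI Qc.
pose lt (x y : R -> Prop) := (forall r, x r -> y r) /\ ~ (forall r, y r -> x r).
have [|e [[eI Qe] emax]] := @maximal_exists _ lt (fun c => ideal c /\ Q c) c _ (conj cI Qc).
  move=> f fQ flt; have [||n nP] := @ideal_acc f; first by move=> i; case: (fQ i).
    by move=> i; case: (flt i).
  by case: (flt n) => _; apply; apply: nP.
exists e => // e' e'I Qe' ee'; apply: contrapT => nee'.
by apply: (emax e').
Qed.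

(** As c is an ideal, the inclusion in c of r times a product of ideals is tested on
products of elements, one from each ideal. *)
Fixpoint prod_in c ps (r : R) : Prop :=
  if ps is p :: qs then forall x, p x -> prod_in c qs (x * r) else c r.

Lemma prod_in_lin c ps r x y : (forall p, List.In p ps -> ideal p) -> ideal c ->
  prod_in c ps x -> prod_in c ps y -> prod_in c ps (r * x + y).
Proof.
elim: ps x y => [|p ps IHps] x y psI cI; first by case: cI => _; apply.
move=> px py z pz; rewrite mulrDr mulrCA; apply: IHps => //; last exact: py.
  by move=> q qps; apply: psI; right.
exact: px.
Qed.

Lemma prod_in_cat c ps qs r :
  prod_in c (ps ++ qs) r = prod_in (prod_in c qs) ps r.
Proof.
elim: ps r => [|p ps IHps] r //=.
by apply/propext; split=> H x px; [rewrite -IHps|rewrite IHps]; apply: H.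
Qed.

Lemma prod_in_mono c e ps r : (forall r, c r -> e r) -> prod_in c ps r -> prod_in e ps r.
Proof.
move=> ce; elim: ps r => [|p ps IHps] r /=; first exact: ce.
by move=> H x px; apply: IHps; apply: H.
Qed.

(** Noetherian induction: if an ideal e that is saturated by a is not prime,
because it contains xy but neither x nor y, then the saturations of e + (x)
and e + (y) have a product contained in e. *)
Lemma primes_over_sat c a : ideal c -> (forall r, c (a * r) -> c r) ->
  exists ps, (forall p, List.In p ps ->
     [/\ prime_ideal p, forall r, c r -> p r & ~ p a]) /\ prod_in c ps 1.
Proof.
move=> cI ca; apply: contrapT => cN.
pose good c := exists ps, (forall p, List.In p ps ->
     [/\ prime_ideal p, forall r, c r -> p r & ~ p a]) /\ prod_in c ps 1.
have [e [eI [ea eN]] emax] := @ideal_maximal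
   (fun c => (forall r, c (a * r) -> c r) /\ ~ good c) c cI (conj ca cN).
have eaX t r : e (a ^+ t * r) -> e r.
  by elim: t => [|t IHt]; rewrite ?mul1r // exprS -mulrA => /ea.
have e1 : ~ e 1 by move=> e1; apply: eN; exists [::].
have bigger x : ~ e x -> good (ideal_sat (ideal_add e x) a).
  move=> ex; apply: contrapT => ng; apply: ex.
  have xI := ideal_add_ideal x eI.
  apply: (emax (ideal_sat (ideal_add e x) a)).
  - exact: ideal_sat_ideal.
  - by split=> // r; apply: ideal_satP.
  - by move=> r er; apply/ideal_satl/ideal_addl.
  - exact/ideal_satl/ideal_addr.
have [xy] : exists xy, [/\ e (xy.1 * xy.2), ~ e xy.1 & ~ e xy.2].
  apply: contrapT => nxy; apply: eN; exists [:: e]; split; last by move=> x /=; rewrite mulr1.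
  move=> p [<-|//]; split=> // [|ea1]; last first.
    by apply/e1/ea; rewrite mulr1.
  split=> // u v euv; apply: contrapT => /not_orP[eu ev].
  by apply: nxy; exists (u, v).
case: xy => x y /= [exy /bigger[ps [psP ps1]] /bigger[qs [qsP qs1]]].
apply: eN; exists (ps ++ qs); split.
  by move=> p pin; case: (List.in_app_or _ _ _ pin) => [/psP|/qsP] [pp ep pa];
    split=> // r er; apply/ep/ideal_satl/ideal_addl.
rewrite prod_in_cat; apply: prod_in_mono ps1 => r [s [u [p [eu rE]]]].
have qsI : forall p, List.In p qs -> ideal p by move=> q /qsP[[]].
have strip l w : prod_in e l (a ^+ s * w) -> prod_in e l w.
  elim: l w => [|q l IHl] w /=; first exact: eaX.
  by move=> H z qz; apply: IHl; rewrite mulrCA; apply: H.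
have inl l w : e w -> prod_in e l w.
  by elim: l w => [|q l IHl] w //= ew z _; apply: IHl; apply: idealM.
have mulx l w : prod_in (ideal_sat (ideal_add e y) a) l w -> prod_in e l (x * w).
  elim: l w => [|q l IHl] w /=; last first.
    by move=> H z qz; rewrite mulrCA; apply: IHl; apply: H.
  move=> [t [v [q [ev wE]]]]; apply: (eaX t); rewrite mulrCA wE mulrDr.
  apply: idealD => //; first exact: idealM.
  by rewrite mulrCA; apply: idealM.
apply: strip; rewrite rE addrC; apply: prod_in_lin => //; last exact: inl.
by rewrite -[x]mulr1; apply: mulx.
Qed.

Lemma primes_over c : ideal c ->
  exists ps, (forall p, List.In p ps ->
     prime_ideal p /\ forall r, c r -> p r) /\ prod_in c ps 1.
Proof.
move=> cI; have [|ps [psP ps1]] := @primes_over_sat c 1 cI.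
  by move=> r; rewrite mul1r.
by exists ps; split=> // p /psP[].
Qed.

(** Otherwise P would contain a product of elements outside of P. *)
Lemma prime_over_prod c ps P r : prime_ideal P -> (forall r, c r -> P r) ->
  prod_in c ps r -> ~ P r ->
  exists2 p, List.In p ps & forall x, p x -> P x.
Proof.
move=> PP cP; elim: ps r => [|p ps IHps] r /=; first by move=> /cP.
move=> H Pr; case: (pselect (forall x, p x -> P x)) => [|/existsNP[x]].
  by exists p; [left|].
move=> /not_implyP[px Px].
have [|q qps qP] := IHps (x * r) (H x px); last by exists q; [right|].
by case: PP => _ _ PM /PM[].
Qed.

End Noetherian.

(** Prime avoidance, by induction on the number of primes. Let p be the first prime.
The others that are contained in p are avoided with p; if an element a avoiding the
remaining primes lies in p, it is corrected by an element b of J that lies in the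
remaining primes but not in p. *)
Lemma prime_avoidance J ps : ideal J ->
  (forall p, List.In p ps -> prime_ideal p /\ ~ forall x, J x -> p x) ->
  exists2 a, J a & forall p, List.In p ps -> ~ p a.
Proof.
move=> JI; elim: {ps}(size ps) {-2}ps (leqnn (size ps)) => [|n IHn] [|p ps] // sz H;
  try by exists 0; [case: JI|].
pose qs := [seq q <- ps | `[< ~ forall x, q x -> p x >]].
have qsP q : List.In q qs -> List.In q ps /\ ~ forall x, q x -> p x.
  rewrite {}/qs; elim: (ps) => //= r l IHl; case: asboolP => rp /=.
    by case=> [<-|/IHl[]]; split; auto.
  by move=> /IHl[]; split; auto.
have psQ q : List.In q ps -> List.In q qs \/ forall x, q x -> p x.
  rewrite {qsP}/qs; elim: (ps) => //= r l IHl; case: asboolP => rp /= [<-|/IHl[]]; auto.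
  by right; apply: contrapT.
have [||a Ja aP] := IHn qs.
- by rewrite size_filter (leq_trans (count_size _ _)).
- by move=> q /qsP[? _]; apply: H; right.
case: (pselect (p a)) => pa; last first.
  exists a => // q [<-//|/psQ[/aP//|qp /qp//]].
have [pP Jp] : prime_ideal p /\ ~ forall x, J x -> p x by apply: H; left.
have [pI p1 pM] := pP.
have [b [Jb pb bq]] : exists b, [/\ J b, ~ p b & forall q, List.In q qs -> q b].
  have qsI q : List.In q qs -> ideal q by move=> /qsP[qps _]; case: (H q (or_intror qps)) => -[].
  elim: (qs) qsI (fun q h => (qsP q h).2) => [|q l IHl] lI lp.
    move/existsNP: Jp => [b /not_implyP[Jb pb]]; by exists b.
  have [||b [Jb pb bq]] := IHl; [by move=> r rl; apply: lI; right|by move=> r rl; apply: lp; right|].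
  have /existsNP[z /not_implyP[qz pz]] : ~ forall x, q x -> p x by apply: lp; left.
  exists (z * b); split; first exact: idealM.
    by move=> /pM[].
  move=> r [<-|rl]; first by rewrite mulrC; apply: idealM => //; apply: lI; left.
  apply: idealM; [by apply: lI; right|exact: bq].
exists (a + b); first exact: idealD.
have pab : ~ p (a + b) by move=> pab; apply: pb; rewrite -[b](addKr a) addrC; apply: idealB.
move=> q [<-//|/psQ[qqs|qp /qp//]] qab.
apply: (aP q qqs); rewrite -[a](addrK b); apply: idealB => //; last exact: bq.
by case: (qsP q qqs) => qps _; case: (H q (or_intror qps)) => -[].
Qed.

End Ideals.

(** * Dimension and parameters *)

Section Dimension.
Variable R : comNzRingType.
Implicit Types (I c : R -> Prop).

(** The complement of V(I) in V(c) has dimension less than d.  When I is the maximal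
ideal, this removes the closed point, and means that dim R / c <= d; when d = 0, it
means that I is contained in the radical of c. *)
Definition chains_lt I c (d : nat) : Prop := forall l (p : nat -> R -> Prop),
  (forall i, (i <= l)%N -> prime_ideal (p i)) -> (forall r, c r -> p 0%N r) ->
  (forall i, (i < l)%N ->
     (forall r, p i r -> p i.+1 r) /\ ~ forall r, p i.+1 r -> p i r) ->
  (~ forall r, I r -> p l r) -> (l < d)%N.

(** The inclusion of I ^ k in an ideal c, tested on products of k elements of I. *)
Definition pow_sub I c (k : nat) : Prop := forall s : seq R, size s = k ->
  (forall x, x \in s -> I x) -> c (\prod_(x <- s) x).

Lemma pow_sub1 I c k a : pow_sub I c k -> I a -> c (a ^+ k).
Proof.
move=> Ik Ia; have -> : a ^+ k = \prod_(x <- nseq k a) x.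
  by elim: k {Ik} => [|k IHk]; rewrite ?big_nil //= big_cons exprS IHk.
by apply: Ik; [rewrite size_nseq|move=> x /nseqP[-> _]].
Qed.

Section Noetherian.
Hypothesis R_noeth : noetherian_ring R.

(** Passing to c' + (a) decreases the dimension if a avoids the primes in ps, whose
product is contained in c': every prime over c' + (a) strictly contains one of them,
by which a chain can be lengthened. *)
Lemma chains_lt_drop I c c' a d ps : ideal c' ->
  (forall r, c r -> c' r) ->
  (forall p, List.In p ps -> [/\ prime_ideal p, forall r, c' r -> p r &
     (~ forall x, I x -> p x) -> ~ p a]) ->
  prod_in c' ps 1 ->
  chains_lt I c d.+1 -> chains_lt I (ideal_add c' a) d.
Proof.
move=> c'I cc' psP ps1 cd l p pP cp pS Ip.
have pl r : p 0%N r -> p l r.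
  have: forall i, (i <= l)%N -> p 0%N r -> p i r.
    by elim=> // i IHi il /(IHi (ltnW il)); case: (pS i il) => + _; apply.
  exact.
have [p0I p01 _] := pP 0%N isT.
have [|q qps qp] := prime_over_prod (pP 0%N isT) _ ps1 p01.
  by move=> r /(ideal_addl a)/cp.
have [qP c'q qa] := psP q qps.
rewrite -ltnS; apply: (cd l.+1 (fun i => if i is j.+1 then p j else q)) => //.
- by case.
- by move=> r /cc'/c'q.
case=> [_|i il]; last exact: pS.
split=> // pq; apply: qa.
  by move=> Iq; apply: Ip => r /Iq/qp/pl.
by apply/pq/cp/ideal_addr.
Qed.

(** A parameter in I. *)
Lemma chains_lt_avoid I c d : ideal I -> ideal c -> chains_lt I c d.+1 ->
  exists2 a, I a & chains_lt I (ideal_add c a) d.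
Proof.
move=> II cI cd; have [ps [psP ps1]] := primes_over R_noeth cI.
pose qs := [seq p <- ps | `[< ~ forall x, I x -> p x >]].
have qsP p : List.In p qs <-> List.In p ps /\ ~ forall x, I x -> p x.
  by rewrite /qs List.filter_In; split=> -[? /asboolP].
have [|a Ia aP] := @prime_avoidance R I qs II.
  by move=> p /qsP[/psP[]].
exists a => //; apply: chains_lt_drop cd => //; last exact: ps1.
by move=> p pps; have [pP cp] := psP p pps; split=> // Ip; apply/aP/qsP.
Qed.

(** On the quotient by its a-power torsion, any a is a parameter. *)
Lemma chains_lt_sat I c a d : ideal c -> chains_lt I c d.+1 ->
  chains_lt I (ideal_add (ideal_sat c a) a) d.
Proof.
move=> cI cd; have satI := ideal_sat_ideal a cI.
have [|ps [psP ps1]] := primes_over_sat R_noeth satI (a := a).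
  by move=> r; apply: ideal_satP.
apply: chains_lt_drop cd => //; [by move=> r; apply: ideal_satl| |exact: ps1].
by move=> p /psP[].
Qed.

Lemma chains_lt0 I c : ideal c -> chains_lt I c 0 -> exists k, pow_sub I c k.
Proof.
move=> cI cd; have [ps [psP ps1]] := primes_over R_noeth cI.
have pI p : List.In p ps -> forall x, I x -> p x.
  move=> pps; apply: contrapT => Ip; have [pP cp] := psP p pps.
  suff : (0 < 0)%N by []; exact: (@cd 0%N (fun=> p)).
exists (size ps) => s; rewrite -[\prod_(x <- s) x]mulr1.
suff H r : prod_in c ps r -> size s = size ps -> (forall x, x \in s -> I x) ->
    c (\prod_(x <- s) x * r) by apply: H.
elim: ps s r pI {psP ps1} => [|p ps IHps] [|y s] r pI //=.
  by rewrite big_nil mul1r.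
move=> H [sz] sI; rewrite big_cons mulrAC mulrC; apply: IHps => //.
- by move=> q qps; apply: pI; right.
- by apply: H; apply: (pI p) (sI y (mem_head _ _)); left.
by move=> x xs; apply: sI; rewrite in_cons xs orbT.
Qed.

(** Let I be the maximal ideal.  When dim R / c <= 1, the localization of R / c at a is
Artinian: modulo c, a power of b becomes divisible by every power of a, after
multiplication by a power of a. *)
Lemma chains_lt1_pow I c a b k : ideal c -> chains_lt I c 1 -> I b ->
  exists T u v, [/\ c u & (a * b) ^+ T = u + v * a ^+ (T + k)].
Proof.
move=> cI cd Ib.
have [e eP] := chains_lt0 (ideal_add_ideal a (ideal_sat_ideal a cI))
  (chains_lt_sat (a := a) cI cd).
have [u [p [[t cu] bE]]] := pow_sub1 eP Ib.
have [u' [p' [cu' E]]] : exists u' p', c u' /\ a ^+ t * b ^+ (e * k) = u' + p' * a ^+ (t + k).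
  elim: k => [|k [v [q [cv E]]]].
    by exists 0, 1; rewrite muln0 addn0 expr0 mulr1 mul1r add0r; case: cI.
  exists (b ^+ e * v + q * a ^+ k * (a ^+ t * u)), (q * p); split.
    apply: idealD => //; exact: idealM.
  rewrite mulnS exprD mulrCA E !exprD exprS bE; ring.
exists (t + e * k)%N, (a ^+ (e * k) * b ^+ t * u'), (b ^+ t * p'); split.
  exact: idealM.
have -> : (a * b) ^+ (t + e * k) = a ^+ (e * k) * b ^+ t * (a ^+ t * b ^+ (e * k)).
  by rewrite exprMn !exprD; ring.
by rewrite E !exprD; ring.
Qed.

End Noetherian.

Definition annihilator (M : lmodType R) : R -> Prop := fun a => forall x : M, a *: x = 0.

Lemma annihilator_ideal (M : lmodType R) : ideal (annihilator M).
Proof.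
split=> [x|r a b aM bM x]; first by rewrite scale0r.
by rewrite scalerDl -scalerA aM bM scaler0 addr0.
Qed.

Section Local.
Variable m : idealr R.
Hypothesis R_local : local_ring m.

(** An ideal that is maximal among the proper ideals over P is equal to m. *)
Lemma proper_sub_max P : ideal P -> ~ P 1 -> forall r, P r -> r \in m.
Proof.
case: R_local => R_noeth _ m_uniq PI P1.
have [e [eI [Pe e1]] emax] := @ideal_maximal R R_noeth
  (fun e => (forall r, P r -> e r) /\ ~ e 1) P PI (conj (fun r h => h) P1).
have em : maximal_ideal (mk_ideal eI e1).
  move=> K eK r; apply/idP/idP => [rK|]; last exact: eK.
  apply/mk_idealP; apply: (emax (fun r => r \in K)) => //.
  - exact: idealr_ideal.
  - split; last by rewrite idealr1.
    by move=> x /Pe ex; apply/eK/mk_idealP.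
  - by move=> x ex; apply/eK/mk_idealP.
by move=> r /Pe er; rewrite -(m_uniq _ em); apply/mk_idealP.
Qed.

Lemma idealr_sub_max (J : idealr R) : {subset J <= m}.
Proof.
by apply: proper_sub_max; [exact: idealr_ideal|rewrite idealr1].
Qed.

Lemma unit_outside_max x : x \notin m -> exists y, y * x = 1.
Proof.
move=> xm; apply: contrapT => nx; move/negP: xm; apply.
apply: (@proper_sub_max (fun r => exists y, r = y * x)); last by exists 1; rewrite mul1r.
  split=> [|r u v [y ->] [z ->]]; first by exists 0; rewrite mul0r.
  by exists (r * y + z); rewrite mulrDl mulrA.
by case=> y yx; apply: nx; exists y.
Qed.

Lemma max_prime : prime_ideal (fun r => r \in m).
Proof.
split; [exact: idealr_ideal|by rewrite idealr1|move=> u v uvm].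
case: (boolP (u \in m)) => [|/unit_outside_max[y yu]]; [by left|right].
by rewrite -[v]mul1r -yu -mulrA idealMr.
Qed.

(** A chain that ends at a prime not containing J ends below m, so m can be added. *)
Lemma krull_dim_chains_lt (M : lmodType R) d (J : idealr R) :
  krull_dim M d -> chains_lt (fun r => r \in J) (annihilator M) d.
Proof.
case=> _ dP l p pP p0 pS Jpl.
pose q i := if (i <= l)%N then p i else fun r => r \in m.
have qP i : prime_ideal (q i).
  by rewrite /q; case: leqP => // il; [exact: pP|exact: max_prime].
apply: (dP l.+1 (fun i => mk_prime (qP i))); split=> [a aM|i].
  by apply/mk_primeP/p0.
rewrite ltnS leq_eqVlt => /orP[/eqP il|il].
  subst i; split=> [r /mk_primeP|H].
    rewrite /q leqnn => pr; apply/mk_primeP; rewrite /q ltnn.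
    have [pI p1 _] := pP l (leqnn l); exact: (proper_sub_max pI p1).
  apply: Jpl => r /idealr_sub_max rm.
  have /H/mk_primeP : r \in mk_prime (qP l.+1) by apply/mk_primeP; rewrite /q ltnn.
  by rewrite /q leqnn.
have [pi ni] := pS i il; split=> [r /mk_primeP|H].
  by rewrite /q (ltnW il) => /pi pr; apply/mk_primeP; rewrite /q il.
apply: ni => r pr; have /H/mk_primeP : r \in mk_prime (qP i.+1).
  by apply/mk_primeP; rewrite /q il.
by rewrite /q (ltnW il).
Qed.

End Local.
End Dimension.

(** * Finiteness of submodule lattices *)

(** For the submodules of X and r = s + 1: X is Artinian and N.dim X <= s. *)
Definition fine_lt (T : Type) (le : T -> T -> Prop) (r : nat) (D : T -> Prop) : Prop :=
  dcc le D /\ dev_lt le r D.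

Lemma fine_strict T T' (le : T -> T -> Prop) (le' : T' -> T' -> Prop) f r
  (D : T -> Prop) (D' : T' -> Prop) : preorder le ->
  (forall t, D t -> D' (f t)) -> strict_on le le' f D ->
  fine_lt le' r D' -> fine_lt le r D.
Proof.
move=> leT fD fs [d1 d2]; split; first exact: (dcc_strict leT fD fs d1).
exact: (dev_strict fD fs d2).
Qed.

Lemma fine_seq T (le : T -> T -> Prop) r (D : T -> Prop) : preorder le ->
  fine_lt le r D -> fine_lt (le_seq le) r.+1 (decr_in le D).
Proof. by move=> leT [d1 d2]; split; [apply: dcc_seq|apply: dev_seq]. Qed.

Lemma fine_indiscrete T (le : T -> T -> Prop) r (D : T -> Prop) :
  (forall a b, D a -> D b -> le a b) -> fine_lt le r D.
Proof.
move=> DD; split=> [c cD _|]; first by exists 0%N => k _; apply: DD.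
by elim: r => [|r IHr]; [move=> a b Da Db _; apply: DD|apply: dev_ltW].
Qed.

Section LinearFunctions.
Variables (R : pzRingType) (V W : lmodType R) (f : V -> W).
Hypothesis f_lin : linear f.

Lemma lin0 : f 0 = 0.
Proof. by have := f_lin (-1) 0 0; rewrite scaleN1r addr0 oppr0 scaleN1r addNr. Qed.
Lemma linD x y : f (x + y) = f x + f y.
Proof. by have := f_lin 1 x y; rewrite !scale1r. Qed.
Lemma linZ a x : f (a *: x) = a *: f x.
Proof. by rewrite -[a *: x]addr0 f_lin lin0 addr0. Qed.
Lemma linB x y : f (x - y) = f x - f y.
Proof. by rewrite linD -scaleN1r linZ scaleN1r. Qed.

Lemma preim_closed (C : submodClosed W) : sub_closed (fun x => f x \in C).
Proof.
by split=> [|a x y xC yC]; rewrite ?lin0 ?rpred0 // f_lin; apply: submod_lin.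
Qed.
Definition preimS C := mkS (preim_closed C).
End LinearFunctions.

Section Lattice.
Variables (R : comNzRingType) (V : lmodType R).
Implicit Types (A B C U : submodClosed V).

Lemma sum_closed A B :
  sub_closed (fun x => exists a b, [/\ a \in A, b \in B & x = a + b]).
Proof.
split=> [|r x y [a [b [aA bB ->]]] [c [d [cA dB ->]]]].
  by exists 0, 0; rewrite !rpred0 addr0.
exists (r *: a + c), (r *: b + d); split; rewrite ?submod_lin //.
by rewrite scalerDr addrACA.
Qed.
Definition sumS A B := mkS (sum_closed A B).

Lemma cap_closed A B : sub_closed (fun x => x \in A /\ x \in B).
Proof.
split=> [|r x y [xA xB] [yA yB]]; first by rewrite !rpred0.
by rewrite !submod_lin.
Qed.
Definition capS A B := mkS (cap_closed A B).

Lemma line_closed (u : V) : sub_closed (fun x => exists r, x = r *: u).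
Proof.
split=> [|r x y [a ->] [b ->]]; first by exists 0; rewrite scale0r.
by exists (r * a + b); rewrite scalerDl scalerA.
Qed.
Definition lineS u := mkS (line_closed u).

Lemma full_closed : sub_closed (fun _ : V => True). Proof. by []. Qed.
Definition fullS := mkS full_closed.
Lemma fullSP x : x \in fullS. Proof. exact/mkSP. Qed.

Lemma sumSl A B : le_sub A (sumS A B).
Proof. by move=> x xA; apply/mkSP; exists x, 0; rewrite rpred0 addr0. Qed.
Lemma sumSr A B : le_sub B (sumS A B).
Proof. by move=> x xB; apply/mkSP; exists 0, x; rewrite rpred0 add0r. Qed.
Lemma sumS_min A B C : le_sub A C -> le_sub B C -> le_sub (sumS A B) C.
Proof. by move=> AC BC x /mkSP[a [b [/AC aC /BC bC ->]]]; apply: rpredD. Qed.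

Definition between A B : submodClosed V -> Prop :=
  fun N => le_sub A N /\ le_sub N B.

Lemma fine_between_sub r A B A' B' : le_sub A' A -> le_sub B B' ->
  fine_lt le_sub r (between A' B') -> fine_lt le_sub r (between A B).
Proof.
move=> AA BB; apply: (@fine_strict _ _ _ _ id) => //; first exact: le_sub_pre.
move=> N [AN NB]; split=> x; first by move=> /AA/AN.
by move=> /NB/BB.
Qed.

(** By the modular law, N |-> (N :&: B, N + B) is strictly monotone. *)
Lemma fine_between_trans r A B C : le_sub A B -> le_sub B C ->
  fine_lt le_sub r (between A B) -> fine_lt le_sub r (between B C) ->
  fine_lt le_sub r (between A C).
Proof.
move=> AB BC [d1 d2] [e1 e2].
apply: (@fine_strict _ _ _ (le_prod le_sub le_sub) (fun N => (capS N B, sumS N B)) _ _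
  (fun u => between A B u.1 /\ between B C u.2)); first exact: le_sub_pre.
- move=> N [AN NC]; split; split=> /=.
  + by move=> x xA; apply/mkSP; split; [apply: AN|apply: AB].
  + by move=> x /mkSP[].
  + exact: sumSr.
  + exact: sumS_min.
- split=> N N' _ _ NN'.
    split=> x /mkSP; first by case=> xN xB; apply/mkSP; split=> //; apply: NN'.
    move=> [a [b [aN bB ->]]]; apply/mkSP; exists a, b; split=> //; exact: NN'.
  case=> /= cap sum x xN'; have /sum/mkSP[a [b [aN bB xE]]] := sumSl B xN'.
  rewrite xE rpredD //; suff /cap/mkSP[] : b \in capS N' B by [].
  apply/mkSP; split=> //.
  have -> : b = x - a by rewrite xE addrC addKr.
  by apply: submodB => //; apply: NN'.
split; first exact: (dcc_prod le_sub_pre le_sub_pre).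
exact: dev_prod.
Qed.

Lemma fine_bool : fine_lt (fun a b : bool => a -> b) 1 (fun=> True).
Proof.
have nat_le : preorder (fun a b : bool => a -> b).
  by split=> // b a c ab bc /ab/bc.
split=> c _ cS.
  case: (pselect (exists n, ~~ c n)) => [[n cn]|cT].
    by exists n => k _; rewrite (negPf cn).
  exists 0%N => k _ _; apply: contrapT => ck.
  by apply: cT; exists k; apply/negP.
case: (pselect (exists n, c n)) => [[n cn]|cF].
  exists n => k nk a b [_ ca _] [_ cb _] ab _; apply: ca.
  exact: (chain_up nat_le cS nk).
exists 0%N => k _ a b _ [_ _ bc] _ /bc ck.
by case: cF; exists k.+1.
Qed.

Section FiniteLength.
Variable m : idealr R.
Hypothesis R_local : local_ring m.

(** (A + R u) / A is zero or simple, so a submodule in between is determined by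
whether it contains u. *)
Lemma fine_line A u : (forall y, y \in m -> y *: u \in A) ->
  fine_lt le_sub 1 (between A (sumS A (lineS u))).
Proof.
move=> uA; apply: (@fine_strict _ _ _ _ (fun N : submodClosed V => u \in N))
  fine_bool => //; first exact: le_sub_pre.
split=> N N' [AN _] [_ N'u] NN'; first exact: NN'.
move=> uN x xN'; have /mkSP[a [_ [aA /mkSP[r ->] xE]]] := N'u x xN'.
have aN := AN a aA; rewrite xE rpredD //.
case: (boolP (r \in m)) => [/uA/AN//|/(unit_outside_max R_local)[y yr]].
apply/rpredZ/uN; rewrite -[u]scale1r -yr -scalerA rpredZ //.
have -> : r *: u = x - a by rewrite xE addrC addKr.
by apply: submodB => //; apply: NN'.
Qed.

Definition adjoin A (us : seq V) := foldr (fun u B => sumS B (lineS u)) A us.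

Lemma adjoinl A us : le_sub A (adjoin A us).
Proof.
elim: us => [|u us IHus] //=.
by move=> x /IHus; apply: sumSl.
Qed.

Lemma adjoin_mem A us u : u \in us -> u \in adjoin A us.
Proof.
elim: us => [//|v us IHus]; rewrite in_cons => /orP[/eqP->|/IHus] /=; last exact: sumSl.
by apply: sumSr; apply/mkSP; exists 1; rewrite scale1r.
Qed.

Lemma adjoin_min A us C : le_sub A C -> (forall u, u \in us -> u \in C) ->
  le_sub (adjoin A us) C.
Proof.
move=> AC; elim: us => [//|u us IHus] usC /=; apply: sumS_min.
  by apply: IHus => v vus; apply: usC; rewrite in_cons vus orbT.
by move=> _ /mkSP[r ->]; rewrite rpredZ // usC // mem_head.
Qed.

Lemma fine_adjoin A us : (forall u y, u \in us -> y \in m -> y *: u \in A) ->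
  fine_lt le_sub 1 (between A (adjoin A us)).
Proof.
elim: us => [|u us IHus] usA /=.
  apply: fine_indiscrete => N N' [_ NA] [AN' _] x /NA; exact: AN'.
apply: (@fine_between_trans _ _ (adjoin A us)).
- exact: adjoinl.
- exact: sumSl.
- by apply: IHus => v y vus; apply: usA; rewrite in_cons vus orbT.
by apply: fine_line => y ym; apply: adjoinl; apply: usA; rewrite ?mem_head.
Qed.

(** Induction on e, through the submodule generated by A and m us. *)
Lemma fine_pow e us A :
  (forall u s, u \in us -> size s = e -> (forall y, y \in s -> y \in m) ->
     (\prod_(y <- s) y) *: u \in A) ->
  fine_lt le_sub 1 (between A (adjoin A us)).
Proof.
case: (R_local) => R_noeth _ _; have [n [g [gm gP]]] := R_noeth m.
elim: e us A => [|e IHe] us A usA.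
  apply: fine_adjoin => u y uus ym; apply: rpredZ.
  by rewrite -[u]scale1r -(big_nil 1 *%R xpredT id) usA.
pose vs := [seq g i *: u | i <- enum 'I_n, u <- us].
apply: (@fine_between_sub _ _ _ A (adjoin (adjoin A vs) us)) => //.
  apply: adjoin_min; last exact: adjoin_mem.
  by move=> x xA; do 2!apply: adjoinl.
apply: (@fine_between_trans _ _ (adjoin A vs)); try exact: adjoinl.
  apply: IHe => _ s /allpairsP[[i u] /= [_ uus ->]] sz sm.
  rewrite scalerA mulrC -[_ * _](big_cons 1 *%R (g i) s xpredT id).
  apply: usA => //=; first by rewrite sz.
  by move=> y; rewrite in_cons => /orP[/eqP->|/sm].
apply: fine_adjoin => u y uus /gP[c ->]; rewrite scaler_suml rpred_sum // => i _.
rewrite -scalerA rpredZ // adjoin_mem //; apply/allpairsP; exists (i, u).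
by rewrite mem_enum.
Qed.

Lemma fine_above e U : finitely_generated V ->
  (forall s (x : V), size s = e -> (forall y, y \in s -> y \in m) ->
     (\prod_(y <- s) y) *: x \in U) ->
  fine_lt le_sub 1 (between U fullS).
Proof.
move=> [n [g gP]] eU.
apply: (@fine_between_sub _ _ _ U (adjoin U [seq g i | i <- enum 'I_n])) => //.
  move=> x _; have [c ->] := gP x; apply: rpred_sum => i _; apply: rpredZ.
  by apply: adjoin_mem; apply/mapP; exists i; rewrite ?mem_enum.
by apply: fine_pow => u s _; apply: eU.
Qed.

End FiniteLength.

(** A submodule C of a c-torsion module is determined, among comparable ones, by the
decreasing sequence of the submodules c ^ n C :&: (0 : c) of (0 : c). *)
Lemma fine_torsion (c : R) r : (forall x : V, exists n, c ^+ n *: x = 0) ->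
  fine_lt le_sub r (fun N : submodClosed V => forall x, x \in N -> c *: x = 0) ->
  fine_lt le_sub r.+1 (fun _ : submodClosed V => True).
Proof.
move=> c_tors fineN.
have KC n C : sub_closed (fun u => c *: u = 0 /\ exists2 w, w \in C & c ^+ n *: w = u).
  split=> [|a x y [cx [w wC wx]] [cy [z zC zy]]].
    by rewrite scaler0; split=> //; exists 0; rewrite ?rpred0 ?scaler0.
  split; first by rewrite scalerDr cy scalerA mulrC -scalerA cx scaler0 addr0.
  exists (a *: w + z); first exact: submod_lin.
  by rewrite scalerDr scalerA mulrC -scalerA wx zy.
pose K (C : submodClosed V) n := mkS (KC n C).
apply: (@fine_strict _ _ _ _ K) (fine_seq le_sub_pre fineN); first exact: le_sub_pre.
  move=> C _; split=> n x /mkSP; first by case.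
  case=> cx [w wC wx]; apply/mkSP; split=> //; exists (c *: w); first exact: rpredZ.
  by rewrite scalerA -exprSr.
split=> C C' _ _ CC'.
  by move=> n x /mkSP[cx [w wC wx]]; apply/mkSP; split=> //; exists w => //; apply: CC'.
move=> KK x; have [n] := c_tors x; elim: n x => [|n IHn] x.
  by rewrite scale1r => -> _; apply: rpred0.
move=> cx xC'; have /KK/mkSP[_ [w wC wE]] : c ^+ n *: x \in K C' n.
  by apply/mkSP; split; [rewrite scalerA -exprS|exists x].
have : x - w \in C.
  apply: IHn; first by rewrite scalerBr wE subrr.
  by apply: submodB => //; apply: CC'.
by move=> /rpredD/(_ wC); rewrite subrK.
Qed.

End Lattice.

(** The union of the images of the theta j is a quotient of a direct limit of copies
of V along multiplication by b.  A submodule C of it is determined by its preimages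
in V, which decrease with j; and as theta j.+1 (b q) = theta j q, the preimage under
theta j.+1 is determined by its image modulo U and the preimage under theta j.  Hence
C is determined by a decreasing sequence of submodules of V / U. *)
Lemma fine_tower (R : comNzRingType) (V X : lmodType R) (b : R)
    (theta : nat -> V -> X) (U : submodClosed V) r :
  (forall j, linear (theta j)) ->
  (forall q, theta 0%N q = 0) ->
  (forall j q, theta j.+1 (b *: q) = theta j q) ->
  (forall u, u \in U -> exists p g, u = b *: p + g /\ forall j, theta j g = 0) ->
  fine_lt le_sub r (between U (fullS V)) ->
  fine_lt le_sub r.+1
    (fun C : submodClosed X => forall x, x \in C -> exists j q, x = theta j q).
Proof.
move=> lin theta0 thetaS UP fineU.
pose F (C : submodClosed X) j := sumS (preimS (lin j) C) U.
apply: (@fine_strict _ _ _ _ F) (fine_seq le_sub_pre fineU); first exact: le_sub_pre.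
  move=> C _; split=> n; first by split=> [|x _]; [exact: sumSr|exact: fullSP].
  apply: sumS_min; last exact: sumSr.
  move=> q /mkSP qC; apply: sumSl; apply/mkSP.
  by rewrite -thetaS (linZ (lin _)) rpredZ.
split=> C C' _ C'P CC'.
  move=> n; apply: sumS_min; last exact: sumSr.
  by move=> q /mkSP qC; apply: sumSl; apply/mkSP/CC'.
move=> FF x xC'; have [j [q xE]] := C'P x xC'; rewrite {}xE in xC' *.
elim: j q xC' => [|j IHj] q qC'; first by rewrite theta0 rpred0.
have /FF/mkSP[n [u [/mkSP nC uU qE]]] : q \in F C' j.+1 by apply/sumSl/mkSP.
have [p [g [uE gP]]] := UP u uU.
have qE' : theta j.+1 q = theta j.+1 n + theta j p.
  by rewrite qE uE !(linD (lin _)) gP addr0 thetaS.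
rewrite qE' rpredD //; apply: IHj.
have -> : theta j p = theta j.+1 q - theta j.+1 n by rewrite qE' addrC addKr.
by apply: submodB => //; apply: CC'.
Qed.

(** * Torsion in injective modules *)

Section GraphExtension.
Variables (R : comNzRingType) (B N : lmodType R) (G : B -> N -> Prop).
Hypothesis G0 : G 0 0.
Hypothesis Glin : forall a x y x' y', G x y -> G x' y' -> G (a *: x + x') (a *: y + y').

Lemma graph_closed : sub_closed (fun u : B * N => G u.1 u.2).
Proof. by split=> // a [x y] [x' y']; apply: Glin. Qed.

Definition graph_fst (u : submod (mkS graph_closed)) : B := (\val u).1.
Definition graph_snd (u : submod (mkS graph_closed)) : N := (\val u).2.

Lemma graph_fst_linear : linear graph_fst.
Proof. by move=> a u v; rewrite /graph_fst linearP. Qed.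
Lemma graph_snd_linear : linear graph_snd.
Proof. by move=> a u v; rewrite /graph_snd linearP. Qed.
HB.instance Definition _ := GRing.isLinear.Build R (submod (mkS graph_closed)) B
  *:%R graph_fst graph_fst_linear.
HB.instance Definition _ := GRing.isLinear.Build R (submod (mkS graph_closed)) N
  *:%R graph_snd graph_snd_linear.

(** A partial linear map is given by its graph, which is a module embedded in B. *)
Lemma injective_extend : injective_module N -> (forall y, G 0 y -> y = 0) ->
  exists h : {linear B -> N}, forall x y, G x y -> h x = y.
Proof.
move=> Ninj Gfun.
have [|h hP] := Ninj _ _ (graph_fst : {linear _ -> _}) (graph_snd : {linear _ -> _}).
  move=> u v /=; rewrite /graph_fst /= => uv; apply: val_inj.
  have: \val (u - v) \in mkS graph_closed by apply: valP.
  move=> /mkSP; rewrite linearB /= uv subrr => /Gfun/eqP.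
  rewrite subr_eq0 => /eqP uv2.
  by move: uv uv2; case: (\val u) => ? ?; case: (\val v) => ? ? /= -> ->.
exists h => x y Gxy.
have Gm : (x, y) \in mkS graph_closed by apply/mkSP.
exact: (hP (Sub (x, y) Gm)).
Qed.
End GraphExtension.

Section Generated.
Variable R : comNzRingType.

(** The sum ranges over [undup S] because the coefficients are a function of the
generator, not of its position. *)
Definition ideal_gen (S : seq R) (u : R) : Prop :=
  exists f : R -> R, u = \sum_(s <- undup S) f s * s.

Lemma ideal_gen_ideal S : ideal (ideal_gen S).
Proof.
split=> [|r _ _ [f ->] [g ->]].
  by exists (fun=> 0); rewrite big1 // => s _; rewrite mul0r.
exists (fun s => r * f s + g s); rewrite mulr_sumr -big_split /=.
by apply: eq_bigr => s _; rewrite mulrDl mulrA.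
Qed.

Lemma ideal_gen_mem S s : s \in S -> ideal_gen S s.
Proof.
rewrite -mem_undup => sS; exists (fun t => (t == s)%:R).
rewrite (bigD1_seq s) ?undup_uniq //= eqxx mul1r big1 ?addr0 // => t /negPf->.
by rewrite mul0r.
Qed.

Lemma ideal_gen_sum S (n : nat) (c g : 'I_n -> R) :
  (forall i, g i \in S) -> ideal_gen S (\sum_i c i * g i).
Proof.
move=> gS; apply: big_ind => [|x y|i _].
- by case: (ideal_gen_ideal S).
- exact: idealD (ideal_gen_ideal S).
by apply: idealM (ideal_gen_ideal S) (ideal_gen_mem _).
Qed.
End Generated.

Section Baer.
Variables (R : comNzRingType) (V : lmodType R).
Implicit Types (T : V -> Prop).

(** Baer's criterion for the injectivity of T. *)
Definition baer_in T : Prop := forall G : R -> V -> Prop,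
  G 0 0 ->
  (forall a r s x y, G r x -> G s y -> G (a * r + s) (a *: x + y)) ->
  (forall r x, G r x -> T x) -> (forall x, G 0 x -> x = 0) ->
  exists2 y, T y & forall r x, G r x -> x = r *: y.

Lemma injective_baer : injective_module V -> baer_in (fun=> True).
Proof.
move=> Vinj G G0 Glin _ Gfun.
have Glin' a (x : R^o) y (x' : R^o) y' := Glin a x x' y y'.
have [h hP] := @injective_extend R R^o V G G0 Glin' Vinj Gfun.
exists (h 1) => // r x /hP <-.
by rewrite -linearZ /= [_ *: _]mulr1.
Qed.

Hypothesis R_noeth : noetherian_ring R.

(** The classical proof that torsion submodules of injective modules over
Noetherian rings are injective; for one element c, the Artin-Rees lemma is the
fact that the ideals (J : c ^ k) become stationary. *)
Lemma baer_torsion T c : baer_in T ->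
  baer_in (fun x => T x /\ exists n, c ^+ n *: x = 0).
Proof.
move=> Tb G G0 Glin GT Gfun.
pose J r := exists x, G r x.
pose Jn n r := exists2 x, G r x & c ^+ n *: x = 0.
have GM a r x : G r x -> G (a * r) (a *: x).
  by move=> Grx; have := Glin a _ _ _ _ Grx G0; rewrite !addr0.
have JI : ideal J.
  split=> [|a r s [x Gx] [y Gy]]; first by exists 0.
  by exists (a *: x + y); apply: Glin.
have [n nP] : exists n, forall k r, Jn k r -> Jn n r.
  apply: (ideal_acc R_noeth) => [i|i r [x Gx cx]].
    split=> [|a r s [x Gx cx] [y Gy cy]]; first by exists 0; rewrite ?scaler0.
    exists (a *: x + y); first exact: Glin.
    by rewrite scalerDr cy scalerA mulrC -scalerA cx scaler0 addr0.
  by exists x => //; rewrite exprS -scalerA cx scaler0.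
have [k kP] : exists k, forall l r, J (c ^+ l * r) -> J (c ^+ k * r).
  apply: (ideal_acc R_noeth (c := fun l r => J (c ^+ l * r))) => [i|i r Jr].
    split=> [|a r s Jr Js]; first by rewrite mulr0; exists 0.
    by rewrite mulrDr mulrCA; case: JI => _; apply.
  by rewrite exprS -mulrA; apply: idealM.
pose G' r x := exists r1 s, G r1 x /\ r = r1 + c ^+ (n + k) * s.
have [||||y Ty yP] := Tb G'.
- by exists 0, 0; rewrite mulr0 addr0.
- move=> a _ _ x y [r [s [Gr ->]]] [r' [s' [Gr' ->]]].
  exists (a * r + r'), (a * s + s'); split; first exact: Glin.
  ring.
- by move=> r x [r1 [s [/GT[]]]].
- move=> x [r [s [Gr /esym/eqP]]]; rewrite addr_eq0 => /eqP rE.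
  have [x1 Gx1 cx1] : Jn n (c ^+ k * - s).
    have [x1 Gx1] : J (c ^+ k * - s).
      by apply: (kP (n + k)%N); exists x; rewrite mulrN -rE.
    by have [_ [l cl]] := GT _ _ Gx1; apply: (nP l); exists x1.
  apply: Gfun; have := Glin (-1) _ _ _ _ (GM (c ^+ n) _ _ Gx1) Gr.
  rewrite cx1 scaler0 add0r rE exprD => H.
  by rewrite (_ : 0 = -1 * (c ^+ n * (c ^+ k * - s)) - c ^+ n * c ^+ k * s) //; ring.
exists y.
  split=> //; exists (n + k)%N; apply/esym/yP; exists 0, 1.
  by rewrite mulr1 add0r.
by move=> r x Gr; apply: yP; exists r, 0; rewrite mulr0 addr0.
Qed.

Definition tors (S : seq R) (x : V) : Prop := forall c, c \in S -> exists n, c ^+ n *: x = 0.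

Lemma tors_closed S : sub_closed (tors S).
Proof.
split=> [|a x y xS yS] c cS; first by exists 0%N; rewrite scaler0.
have [[n nx] [k ky]] := (xS c cS, yS c cS); exists (n + k)%N.
rewrite scalerDr scalerA.
have -> : c ^+ (n + k) * a = (c ^+ k * a) * c ^+ n by rewrite exprD; ring.
by rewrite -scalerA nx scaler0 add0r exprD -scalerA ky scaler0.
Qed.

Lemma tors_cons c S x : tors (c :: S) x <-> tors S x /\ exists n, c ^+ n *: x = 0.
Proof.
split=> [xS|[xS xc] e]; last by rewrite in_cons => /orP[/eqP->|/xS].
by split=> [e eS|]; apply: xS; rewrite in_cons ?eqxx ?eS ?orbT.
Qed.

Lemma baer_tors S : injective_module V -> baer_in (tors S).
Proof.
move=> Vinj; elim: S => [|c S IHS].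
  have -> : tors [::] = (fun=> True) by apply/funext => x; apply/propext; split.
  exact: injective_baer.
suff -> : tors (c :: S) = (fun x => tors S x /\ exists n, c ^+ n *: x = 0).
  exact: baer_torsion.
by apply/funext => x; apply/propext; exact: tors_cons.
Qed.

(** An injective module T maps onto its localization at c.  When c ^ t kills all the
c-power torsion of R, the map c ^ (t + k) s |-> c ^ t s x is well defined on the ideal
generated by c ^ (t + k); it is multiplication by some x'. *)
Lemma baer_div T c k x : sub_closed T -> baer_in T -> T x ->
  exists t x', T x' /\ c ^+ t *: x = c ^+ (t + k) *: x'.
Proof.
move=> [T0 Tlin] Tb Tx.
have [t tP] : exists t, forall l r, c ^+ l * r = 0 -> c ^+ t * r = 0.
  apply: (ideal_acc R_noeth (c := fun l r => c ^+ l * r = 0)) => [i|i r cr].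
    split=> [|a r s cr cs]; first by rewrite mulr0.
    by rewrite mulrDr mulrCA cr cs mulr0 addr0.
  by rewrite exprS -mulrA cr mulr0.
have [||||y Ty yP] := Tb (fun r y => exists s, r = c ^+ (t + k) * s /\ y = (c ^+ t * s) *: x).
- by exists 0; rewrite !mulr0 scale0r.
- move=> a _ _ _ _ [r [-> ->]] [s [-> ->]]; exists (a * r + s).
  split; first by ring.
  by rewrite scalerA -scalerDl; congr (_ *: _); ring.
- move=> _ _ [s [_ ->]]; have := Tlin (c ^+ t * s) _ _ Tx T0; by rewrite addr0.
- by move=> _ [s [/esym/tP -> ->]]; rewrite scale0r.
by exists t, y; split=> //; apply: yP; exists 1; rewrite !mulr1.
Qed.

(** Expand one factor u over the generators s: the other factors kill s x by
induction on the sum of the exponents, as s x needs one s less than x. *)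
Lemma tors_pow_exp (S : seq R) (n : R -> nat) : exists N, forall x : V,
  (forall s, s \in S -> s ^+ n s *: x = 0) ->
  forall us : seq R, size us = N -> (forall u, u \in us -> ideal_gen S u) ->
  (\prod_(u <- us) u) *: x = 0.
Proof.
exists (\sum_(s <- undup S) n s).+1 => x nP.
have [N NE nN] : exists2 N, N = (\sum_(s <- undup S) n s)%N
  & (\sum_(s <- undup S) n s <= N)%N by exists (\sum_(s <- undup S) n s)%N.
rewrite -{}NE; elim: N n x nP nN => [|N IHN] n x nP nN [|u us] //= [szus] usS.
  rewrite (size0nil szus) big_seq1; have [f ->] := usS u (mem_head _ _).
  rewrite scaler_suml big_seq big1 // => s sU; have sS : s \in S by rewrite -mem_undup.
  rewrite -scalerA; have := nP s sS.
  suff -> : n s = 0%N by rewrite scale1r => ->; rewrite !scaler0.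
  by apply/eqP; move: nN; rewrite leqn0 sum_nat_seq_eq0 => /allP; apply.
rewrite big_cons; have [f ->] := usS u (mem_head _ _).
rewrite mulr_suml scaler_suml big_seq big1 // => s sU.
have sS : s \in S by rewrite -mem_undup.
have usS' v : v \in us -> ideal_gen S v.
  by move=> vus; apply: usS; rewrite in_cons vus orbT.
rewrite -mulrA -scalerA mulrC -scalerA.
case: (posnP (n s)) => [n0|npos].
  by have := nP s sS; rewrite n0 scale1r => ->; rewrite !scaler0.
pose n' := [eta n with s |-> (n s).-1].
rewrite (IHN n' (s *: x) _ _ us szus usS') ?scaler0 //.
  move=> r rS; rewrite /n' /=; case: eqP => [->|_].
    by rewrite scalerA -exprSr prednK // nP.
  by rewrite scalerA mulrC -scalerA nP // scaler0.
move: nN; rewrite !(bigD1_seq s) ?undup_uniq //= eqxx => nN.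
rewrite -ltnS; apply: leq_trans nN; rewrite -addSn prednK // leq_add2l.
by apply: leq_sum => r /negPf ->.
Qed.

Lemma tors_pow (S : seq R) x : tors S x -> exists N, forall us : seq R, size us = N ->
  (forall u, u \in us -> ideal_gen S u) ->
  (\prod_(u <- us) u) *: x = 0.
Proof.
move=> xS; have /choice[n nP] s : exists n, s \in S -> s ^+ n *: x = 0.
  by case: (boolP (s \in S)) => [/xS[n]|_]; [exists n|exists 0%N].
by have [N NP] := tors_pow_exp S n; exists N; apply: NP.
Qed.

End Baer.

(** * Cohomology with supports, elementwise *)

Section Resolution.
Variables (R : comNzRingType) (M : lmodType R) (E : injective_resolution M).
Hypothesis R_noeth : noetherian_ring R.
Local Notation X := (res_mod E).
Local Notation d := (res_d E).
Local Notation aug := (res_aug E).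

Lemma res_ker0 x : d 0%N x = 0 -> exists n, aug n = x.
Proof.
move=> dx; have: x \in kernel (d 0%N) by rewrite inE dx.
by rewrite res_exact0 inE => /asboolP.
Qed.

Lemma res_d_aug n : d 0%N (aug n) = 0.
Proof.
apply/eqP; have: aug n \in kernel (d 0%N) by rewrite res_exact0 inE; apply/asboolP; exists n.
by rewrite inE.
Qed.

Lemma res_kerS i x : d i.+1 x = 0 -> exists y, d i y = x.
Proof.
move=> dx; have: x \in kernel (d i.+1) by rewrite inE dx.
by rewrite res_exactS inE => /asboolP.
Qed.

Lemma res_dd i x : d i.+1 (d i x) = 0.
Proof.
apply/eqP; have: d i x \in kernel (d i.+1) by rewrite res_exactS inE; apply/asboolP; exists x.
by rewrite inE.
Qed.

Lemma tors_map (V W : lmodType R) (f : {linear V -> W}) S x : tors S x -> tors S (f x).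
Proof. by move=> xS c /xS[n cx]; exists n; rewrite -linearZ cx linear0. Qed.

Lemma res_div S i c k (x : X i) : tors S x ->
  exists t x', tors S x' /\ c ^+ t *: x = c ^+ (t + k) *: x'.
Proof.
move=> xS; apply: (@baer_div R (X i) R_noeth (tors S)) => //.
  exact: tors_closed.
exact: (baer_tors R_noeth (@res_injective R M E i)).
Qed.

(** Multiplication by r in Ann M lifts the zero map of M, so it is null-homotopic on
the resolution.  The homotopy h is constructed degree by degree, by extending the map
d x |-> r x - d (h x); only its value on cocycles is recorded. *)
Lemma annihilator_homotopy r : annihilator M r ->
  (forall z : X 0%N, d 0%N z = 0 -> r *: z = 0) /\
  forall i, exists h : {linear X i.+1 -> X i}, forall z, d i.+1 z = 0 -> r *: z = d i (h z).
Proof.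
move=> rM; have r0 z : d 0%N z = 0 -> r *: z = 0.
  by move/res_ker0=> [n <-]; rewrite -linearZ rM linear0.
split=> //; elim=> [|i [h hP]].
  have [|||h hP] := @injective_extend R (X 1%N) (X 0%N) (fun b n => exists x, b = d 0%N x /\ n = r *: x)
    _ _ (@res_injective R M E 0%N).
  - by exists 0; rewrite scaler0 linear0.
  - move=> a _ _ _ _ [x [-> ->]] [y [-> ->]]; exists (a *: x + y).
    by rewrite !linearP.
  - by move=> _ [x [/esym/r0 ? ->]].
  exists h => z /res_kerS[x <-].
  by rewrite (hP _ (r *: x)) ?linearZ //; exists x.
have [|||h' hP'] := @injective_extend R (X i.+2) (X i.+1)
    (fun b n => exists x, b = d i.+1 x /\ n = r *: x - d i (h x))
    _ _ (@res_injective R M E i.+1).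
- by exists 0; rewrite !linear0 ?scaler0 ?oppr0 ?addr0.
- move=> a _ _ _ _ [x [-> ->]] [y [-> ->]]; exists (a *: x + y).
  by rewrite !linearP /= !scalerA [r * a]mulrC addrACA.
- by move=> _ [x [/esym/hP ? ->]]; apply/eqP; rewrite subr_eq0; apply/eqP.
exists h' => z /res_kerS[x <-].
rewrite (hP' _ (r *: x - d i (h x))); last by exists x.
by rewrite linearB res_dd subr0 linearZ.
Qed.

(** The subcomplexes that occur, of elements with supports in varying ideals, are
given by predicates T on the same resolution. *)
Definition bounds (T : forall i, X i -> Prop) i : X i -> Prop :=
  match i return X i -> Prop with
  | 0 => fun z => z = 0
  | j.+1 => fun z => exists2 w, T j w & d j w = z
  end.
Arguments bounds : clear implicits.

Local Notation bd S := (bounds (fun i => @tors R (X i) S)).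

Lemma bounds_sub (T T' : forall i, X i -> Prop) i z :
  (forall i z, T i z -> T' i z) -> bounds T i z -> bounds T' i z.
Proof. by move=> TT; case: i z => [//|i] z [w Tw]; exists w; [apply: TT|]. Qed.

Lemma bounds_closed S i : sub_closed (bd S i).
Proof.
case: i => [|i]; first by split=> // a x y -> ->; rewrite scaler0 addr0.
split=> [|a _ _ [x xS <-] [y yS <-]].
  by exists 0; rewrite ?linear0 //; case: (tors_closed (X i) S).
exists (a *: x + y); rewrite ?linearP //.
by case: (tors_closed (X i) S) => _; apply.
Qed.

Lemma annihilator_bounds S r i (z : X i) : annihilator M r -> tors S z -> d i z = 0 ->
  bd S i (r *: z).
Proof.
move=> rM zS dz; have [h0 hS] := annihilator_homotopy rM.
case: i z zS dz => [|i] z zS dz /=; first exact: h0.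
have [h hP] := hS i; exists (h z); last by rewrite hP.
exact: tors_map.
Qed.

(** The quotient of the complex of S-torsion by that of c, S-torsion is the
localization at c of the former, which is exact if the cohomology of the former
is c-torsion. *)
Section AddGenerator.
Variables (S : seq R) (c : R).
Hypothesis cohom_tors : forall i (z : X i), tors S z -> d i z = 0 ->
  exists N, bd S i (c ^+ N *: z).

Lemma cohom_cons_surj i (z : X i) : tors S z -> d i z = 0 ->
  exists2 z', tors (c :: S) z' & bd S i (z - z').
Proof.
move=> zS dz; have [N] := cohom_tors zS dz.
case: i z zS dz => [|i] z zS dz /=.
  by move=> cz; exists z; rewrite ?subrr //; apply/tors_cons; split=> //; exists N.
move=> [w wS dw]; have [t [w' [wS' ww']]] := res_div c N wS.
exists (z - d i w'); last by exists w'; rewrite // opprB addrC subrK.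
apply/tors_cons; split; last first.
  exists (t + N)%N; have /(congr1 (d i)) := ww'; rewrite !linearZ /= dw => e.
  by rewrite scalerBr -e scalerA -exprD subrr.
by apply: (sub_closedB (tors_closed _ S)) => //; apply: tors_map.
Qed.

Lemma cohom_cons_inj i (z : X i) : tors (c :: S) z -> d i z = 0 ->
  bd S i z -> bd (c :: S) i z.
Proof.
case: i z => [//|i] z /tors_cons[_ [k ck]] _ [w wS wz]; rewrite -{z}wz in ck *.
have cw : tors S (c ^+ k *: w) by apply: sub_closedZ (tors_closed _ S) wS.
have [|N] := cohom_tors cw; first by rewrite linearZ.
rewrite scalerA -exprD; case: i w {ck cw} wS => [|i] w wS /=.
  by move=> cw; exists w => //; apply/tors_cons; split=> //; exists (N + k)%N.
move=> [v vS dv]; have [t [v' [vS' vv']]] := res_div c (N + k) vS.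
exists (w - d i v'); last by rewrite linearB res_dd subr0.
apply/tors_cons; split.
  by apply: (sub_closedB (tors_closed _ S)) => //; apply: tors_map.
exists (t + (N + k))%N; have /(congr1 (d i)) := vv'; rewrite !linearZ /= dv => e.
by rewrite scalerBr -e scalerA -exprD subrr.
Qed.

End AddGenerator.
End Resolution.
Arguments bounds {R M E} T i z.

(** Let S be contained in I and generate an ideal with the same radical as I modulo
Ann M.  Then S and I give the same cohomology with supports: a generator of I may be
added to S, because a power of it acts on the cohomology as an element of (S). *)
Section Supports.
Variables (R : comNzRingType) (M : lmodType R) (E : injective_resolution M).
Hypothesis R_noeth : noetherian_ring R.
Local Notation X := (res_mod E).
Local Notation d := (res_d E).
Local Notation bd S := (bounds (fun i => @tors R (X i) S)).

Lemma bounds_d T i (z : X i) : bounds T i z -> d i z = 0.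
Proof.
case: i z => [|i] z /=; first by move=> ->; rewrite linear0.
by move=> [w _ <-]; rewrite res_dd.
Qed.

Variables (I : idealr R) (S : seq R).
Hypothesis S_I : {subset S <= I}.
Hypothesis S_rad : forall c, c \in I ->
  exists e r u, [/\ annihilator M r, ideal_gen S u & c ^+ e = r + u].

Lemma tors_sub (V : lmodType R) (T T' : seq R) (x : V) :
  {subset T <= T'} -> tors T' x -> tors T x.
Proof. by move=> TT xT c /TT/xT. Qed.

Lemma cohom_tors_rad S' c i (z : X i) : {subset S <= S'} -> c \in I ->
  tors S' z -> d i z = 0 -> exists N, bd S' i (c ^+ N *: z).
Proof.
move=> SS cI zS dz; have [e [r [u [rM uS cE]]]] := S_rad cI.
have [N NP] := tors_pow (tors_sub SS zS).
have uN : u ^+ N *: z = 0.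
  have := NP (nseq N u) (size_nseq _ _); rewrite big_nseq -Monoid.iteropE => -> //.
  by move=> v /nseqP[->].
have [q qE] : exists q, (r + u) ^+ N = r * q + u ^+ N.
  elim: (N) => [|k [q qE]]; first by exists 0; rewrite mulr0 add0r.
  exists ((r + u) ^+ k + u * q); rewrite exprS mulrDl {2}qE mulrDr exprS; ring.
exists (e * N)%N; rewrite exprM cE qE scalerDl uN addr0 -scalerA.
apply: annihilator_bounds => //; first exact: sub_closedZ (tors_closed _ _) zS.
by rewrite linearZ /= dz scaler0.
Qed.

Lemma cohom_cat_surj cs i (z : X i) : {subset cs <= I} -> tors S z -> d i z = 0 ->
  exists2 z', tors (cs ++ S) z' & bd S i (z - z').
Proof.
move=> + zS dz; elim: cs => [|c cs IHcs] csI.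
  by exists z => //; rewrite subrr; case: (bounds_closed E S i).
have [|z1 z1S zz1] := IHcs; first by move=> x xcs; apply: csI; rewrite in_cons xcs orbT.
have dz1 : d i z1 = 0.
  by have /(congr1 -%R) := bounds_d zz1; rewrite linearB /= dz sub0r opprK oppr0.
have SS : {subset S <= cs ++ S} by move=> x xS; rewrite mem_cat xS orbT.
have [j w wS dw|||z2 z2S zz2] := @cohom_cons_surj _ _ E R_noeth (cs ++ S) c _ i z1 => //.
  by apply: cohom_tors_rad => //; apply: csI; apply: mem_head.
exists z2 => //; rewrite -(subrK z1 z) -addrA.
apply: sub_closedD (bounds_closed E S i) zz1 _.
by apply: bounds_sub zz2 => j y; apply: tors_sub.
Qed.

Lemma cohom_cat_inj cs i (z : X i) : {subset cs <= I} -> tors (cs ++ S) z ->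
  d i z = 0 -> bd S i z -> bd (cs ++ S) i z.
Proof.
move=> + + dz bz; elim: cs => [//|c cs IHcs] csI zS.
apply: cohom_cons_inj => //.
  move=> j y yS dy; apply: cohom_tors_rad => //; last by apply/csI/mem_head.
  by move=> x xS; rewrite mem_cat xS orbT.
apply: IHcs; first by move=> x xcs; apply: csI; rewrite in_cons xcs orbT.
by move/tors_cons: zS => [].
Qed.

Lemma torsion_tors (V : lmodType R) (x : V) c : c \in I -> x \in torsion I V ->
  exists n, c ^+ n *: x = 0.
Proof.
move=> cI; rewrite inE => /asboolP[n nP]; exists n; apply: nP.
exists 1%N, (fun=> 1), (fun _ _ => c); split=> //.
by rewrite big_ord_recl big_ord0 addr0 mul1r prodr_const card_ord.
Qed.

(** The generators of I are added in front of S, as in [cohom_cat_surj]. *)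
Lemma torsion_gen : exists2 cs, {subset cs <= I} &
  forall (V : lmodType R) (x : V), x \in torsion I V <-> tors (cs ++ S) x.
Proof.
have [n [g [gI gP]]] := R_noeth I.
exists (codom g) => [_ /codomP[i ->]//|V x]; split.
  move=> xI c; rewrite mem_cat => /orP[/codomP[i ->]|/S_I cI]; exact: torsion_tors xI.
move=> /tors_pow[N NP]; rewrite inE; apply/asboolP; exists N => r [k [c [a [aI ->]]]].
rewrite scaler_suml big1 // => i _; rewrite -scalerA.
have := NP [seq a i j | j <- enum 'I_N].
rewrite size_map size_enum_ord big_map big_enum /= => -> //; first by rewrite scaler0.
move=> _ /mapP[j _ ->]; have [f ->] := gP _ (aI i j).
by apply: ideal_gen_sum => l; rewrite mem_cat codom_f.
Qed.

Local Notation bI := (bounds (fun i x => x \in torsion I (X i))).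

Lemma supports_surj i (z : X i) : tors S z -> d i z = 0 ->
  exists2 z', z' \in torsion I (X i) & bd S i (z - z').
Proof.
move=> zS dz; have [cs csI csP] := torsion_gen.
have [z' z'S zz'] := cohom_cat_surj csI zS dz.
by exists z' => //; apply/csP.
Qed.

Lemma supports_bounds i (z : X i) : z \in torsion I (X i) -> d i z = 0 ->
  (bI i z <-> bd S i z).
Proof.
move=> zI dz; have [cs csI csP] := torsion_gen; split.
  by apply: bounds_sub => j y yI c cS; apply: torsion_tors yI; apply: S_I.
move=> bz; apply: (@bounds_sub _ _ _ (fun j => @tors R (X j) (cs ++ S))).
  by move=> j y yS; apply/csP.
by apply: cohom_cat_inj => //; apply/csP.
Qed.

Section Class.
Variable i : nat.
Local Notation H := (local_cohomology I E i).

(** A relation, because z has to be a cocycle with supports in I. *)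
Definition represents (z : X i) (h : H) : Prop :=
  exists u, \val (\val u) = z /\
    quotmod_pi (trace_submod (kernel (Gamma_map (I := I) (res_d E i)))
      (coboundaries (fun j => Gamma_map (I := I) (res_d E j)) i)) u = h.

Lemma represents_cocycle z h : represents z h -> z \in torsion I (X i) /\ d i z = 0.
Proof.
move=> [u [<- _]]; split; first exact: (valP (val u)).
by have := valP u; rewrite inE => /eqP/(congr1 val).
Qed.

Lemma represents_exists z : z \in torsion I (X i) -> d i z = 0 -> exists h, represents z h.
Proof.
move=> zI dz; pose v : Gamma I (X i) := Sub z zI.
have vK : v \in kernel (Gamma_map (I := I) (res_d E i)).
  by rewrite inE; apply/eqP/val_inj.
by eexists; exists (Sub v vK : submod _); split.
Qed.

Lemma represents_surj h : exists z, represents z h.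
Proof. by have [u uh] := subquot_repr h; exists (\val (\val u)), u. Qed.

Lemma represents_linear a z h z' h' : represents z h -> represents z' h' ->
  represents (a *: z + z') (a *: h + h').
Proof.
move=> [u [<- <-]] [v [<- <-]]; exists (a *: u + v); by rewrite !linearP.
Qed.

Lemma represents0 z h : represents z h -> (h = 0 <-> bI i z).
Proof.
move=> [u [<- <-]].
set A := trace_submod _ _; have := quotmod_piE A u 0; rewrite subr0 linear0 inE => e.
have {e} -> : quotmod_pi A u = 0 <->
    \val u \in coboundaries (fun j => Gamma_map (I := I) (res_d E j)) i.
  by rewrite e; split=> /eqP.
case: (i) (val u) => [|j] v /=.
  by rewrite inE; split=> [/eqP->//|v0]; apply/eqP/val_inj.
rewrite inE; split=> [/asboolP[w <-]|[w wI wv]].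
  by exists (\val w) => //; apply: (valP w).
by apply/asboolP; exists (Sub w wI); apply: val_inj.
Qed.

End Class.
End Supports.

(** * Top local cohomology as a direct limit *)

Section Presentation.
Variables (R : comNzRingType) (M : lmodType R).

(** H is the direct limit of the quotients of M by the submodules N k, with
transition maps the multiplications by c; phi k n is the class of the fraction
n / c ^ k. *)
Definition presentation (H : lmodType R) (c : R) (N : nat -> M -> Prop)
    (phi : nat -> M -> H) : Prop :=
  [/\ forall k, linear (phi k),
      forall k n, phi k.+1 (c *: n) = phi k n,
      forall h, exists k n, h = phi k n &
      forall k n, phi k n = 0 <-> exists t, N (k + t)%N (c ^+ t *: n)].

Variable E : injective_resolution M.
Hypothesis R_noeth : noetherian_ring R.
Local Notation X := (res_mod E).
Local Notation d := (res_d E).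
Local Notation aug := (res_aug E).
Local Notation bd S := (bounds (fun i => @tors R (X i) S)).

(** Phi k n z means that the cocycle z represents n / c ^ k in the cohomology with
supports in S.  A relation is easier to provide than a map, since the cochains that
connect n with z involve choices and exist only after raising k. *)
Section FromRelation.
Variables (I : idealr R) (S : seq R) (i : nat) (c : R) (N : nat -> M -> Prop).
Variable Phi : nat -> M -> X i -> Prop.
Hypothesis S_I : {subset S <= I}.
Hypothesis S_rad : forall c, c \in I ->
  exists e r u, [/\ annihilator M r, ideal_gen S u & c ^+ e = r + u].
Hypothesis N0 : forall k, N k 0.
Hypothesis NS : forall k n, N k n -> N k.+1 (c *: n).
Hypothesis Phi_linear : forall k a n z n' z',
  Phi k n z -> Phi k n' z' -> Phi k (a *: n + n') (a *: z + z').
Hypothesis Phi_shift : forall k n z, Phi k n z -> Phi k.+1 (c *: n) z.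
Hypothesis Phi_cocycle : forall k n z, Phi k n z -> tors S z /\ d i z = 0.
Hypothesis Phi_surj : forall z, tors S z -> d i z = 0 -> exists k n, Phi k n z.
Hypothesis Phi_total : forall k n, exists t z, Phi (k + t)%N (c ^+ t *: n) z.
Hypothesis Phi_null : forall k n z, Phi k n z ->
  (bd S i z <-> exists t, N (k + t)%N (c ^+ t *: n)).

Local Notation H := (local_cohomology I E i).

(** The cocycle z with supports in S is replaced by a cohomologous cocycle z' with
supports in I. *)
Let Psi k n (h : H) := exists t z z',
  [/\ Phi (k + t)%N (c ^+ t *: n) z, represents z' h & bd S i (z - z')].

Lemma Phi_raise k n z s : Phi k n z -> Phi (k + s)%N (c ^+ s *: n) z.
Proof.
move=> Pz; elim: s => [|s IHs]; first by rewrite addn0 scale1r.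
by rewrite addnS exprS -scalerA; apply: Phi_shift.
Qed.

Lemma N_raise k n s : N k n -> N (k + s)%N (c ^+ s *: n).
Proof.
move=> Pz; elim: s => [|s IHs]; first by rewrite addn0 scale1r.
by rewrite addnS exprS -scalerA; apply: NS.
Qed.

Lemma Psi_raise k n h : Psi k n h -> exists t, forall s, (t <= s)%N -> exists z z',
  [/\ Phi (k + s)%N (c ^+ s *: n) z, represents z' h & bd S i (z - z')].
Proof.
move=> [t [z [z' [Pz zh zz]]]]; exists t => s /subnKC <-; exists z, z'; split=> //.
by rewrite addnA addnC exprD mulrC -scalerA addnC; apply: Phi_raise.
Qed.

Lemma Psi_linear k a n h n' h' : Psi k n h -> Psi k n' h' ->
  Psi k (a *: n + n') (a *: h + h').
Proof.
move=> /Psi_raise[t tP] /Psi_raise[s sP].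
have [z [y [Pz yh zy]]] := tP _ (leq_maxl t s).
have [z' [y' [Pz' yh' zy']]] := sP _ (leq_maxr t s).
exists (maxn t s), (a *: z + z'), (a *: y + y'); split.
- by rewrite scalerDr scalerA mulrC -scalerA; apply: Phi_linear.
- exact: represents_linear.
rewrite opprD addrACA -scalerBr; apply: (bounds_closed E S i).2 => //.
Qed.

Lemma Psi_null k n h : Psi k n h -> (h = 0 <-> exists t, N (k + t)%N (c ^+ t *: n)).
Proof.
move=> [t [z [z' [Pz zh zz]]]].
have [z'I dz'] := represents_cocycle zh.
rewrite (represents0 zh) (supports_bounds R_noeth S_I S_rad z'I dz').
have -> : bd S i z' <-> bd S i z.
  have bC := bounds_closed E S i.
  split=> bz; first by rewrite -(subrK z' z); apply: sub_closedD bC _ _.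
  by rewrite -[z'](subKr z); apply: sub_closedB bC _ _.
rewrite (Phi_null Pz); split=> -[s sP].
  by exists (t + s)%N; rewrite addnA exprD mulrC -scalerA.
exists s; rewrite -addnA [(t + s)%N]addnC addnA scalerA -exprD [(s + t)%N]addnC.
by rewrite exprD -scalerA; apply: N_raise.
Qed.

Lemma Psi_total k n : exists h, Psi k n h.
Proof.
have [t [z Pz]] := Phi_total k n; have [zS dz] := Phi_cocycle Pz.
have [z' z'I zz'] := supports_surj R_noeth S_I S_rad zS dz.
have dz' : d i z' = 0.
  by have /(congr1 -%R) := bounds_d zz'; rewrite linearB /= dz sub0r opprK oppr0.
by have [h zh] := represents_exists z'I dz'; exists h, t, z, z'.
Qed.

Lemma presentation_of_relation : exists phi : nat -> M -> H, presentation c N phi.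
Proof.
have uniq k n h h' : Psi k n h -> Psi k n h' -> h = h'.
  move=> Ph /(Psi_linear (-1) Ph) /Psi_null P; apply/eqP; rewrite -subr_eq0 -oppr_eq0.
  apply/eqP; rewrite opprB addrC -scaleN1r; apply/P; exists 0%N.
  by rewrite scaleN1r addNr scaler0.
have /choice[phi phiP] (u : nat * M) : exists h, Psi u.1 u.2 h by apply: Psi_total.
pose f k n := phi (k, n).
have fP k n h : Psi k n h -> f k n = h by apply: uniq; apply: (phiP (k, n)).
exists f; split.
- by move=> k a n n'; apply/fP/Psi_linear; [apply: (phiP (k, n))|apply: (phiP (k, n'))].
- move=> k n; apply: fP; have /Psi_raise[t /(_ t.+1 (leqnSn t))[z [z' [Pz zh zz]]]] := phiP (k, n).
  by exists t, z, z'; split=> //; rewrite addSnnS scalerA -exprSr.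
- move=> h; have [z zh] := represents_surj h.
  have [zI dz] := represents_cocycle zh.
  have [|k [n Pz]] := Phi_surj _ dz.
    by move=> s sS; apply: torsion_tors zI; apply: S_I.
  exists k, n; apply/esym/fP; exists 0%N, z, z.
  by rewrite addn0 scale1r subrr; split=> //; case: (bounds_closed E S i).
- by move=> k n; apply/Psi_null/(phiP (k, n)).
Qed.

End FromRelation.

Variable I : idealr R.

Lemma scale_pow0 (V : lmodType R) (c : R) k t (x : V) :
  c ^+ k *: x = 0 -> c ^+ (t + k) *: x = 0.
Proof. by move=> cx; rewrite exprD -scalerA cx scaler0. Qed.

Lemma presentation0 :
  (forall c, c \in I -> exists e r u, [/\ annihilator M r, ideal_gen [::] u & c ^+ e = r + u]) ->
  exists phi : nat -> M -> local_cohomology I E 0, presentation 1 (fun _ n => n = 0) phi.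
Proof.
move=> S_rad; apply: (@presentation_of_relation I [::] 0%N 1 _ (fun _ n z => z = aug n)) => //.
- by move=> k n ->; rewrite scaler0.
- by move=> k a n _ n' _ -> ->; rewrite linearP.
- by move=> k n z ->; rewrite scale1r.
- by move=> k n _ ->; split; [move=> ?; rewrite in_nil|exact: res_d_aug].
- by move=> z _ /res_ker0[n <-]; exists 0%N, n.
- by move=> k n; exists 0%N, (aug n); rewrite scale1r.
move=> k n z ->; split=> [/= augn|[t]]; last by rewrite expr1n scale1r => ->; rewrite linear0.
by exists 0%N; rewrite scale1r; apply: (@res_aug_inj R M E); rewrite augn linear0.
Qed.

(** H^1 is the cokernel of M -> M_a: a cocycle z with a-torsion is d e with
e = n / a ^ k in the localization of the resolution at a. *)
Lemma presentation1 a : a \in I ->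
  (forall c, c \in I -> exists e r u, [/\ annihilator M r, ideal_gen [:: a] u & c ^+ e = r + u]) ->
  exists phi : nat -> M -> local_cohomology I E 1,
    presentation a (fun k n => exists p, n = a ^+ k *: p) phi.
Proof.
move=> aI S_rad; apply: (@presentation_of_relation I [:: a] 1%N a _
  (fun k n z => exists e, d 0%N e = z /\ a ^+ k *: e = aug n)) => //.
- by move=> s; rewrite inE => /eqP->.
- by move=> k; exists 0; rewrite scaler0.
- by move=> k _ [p ->]; exists p; rewrite scalerA -exprS.
- move=> k r n _ n' _ [e [<- en]] [e' [<- en']]; exists (r *: e + e').
  by rewrite !linearP /= -en -en' !scalerA [r * _]mulrC.
- by move=> k n _ [e [<- en]]; exists e; rewrite exprS -scalerA en linearZ.
- move=> k n _ [e [<- en]]; split; last exact: res_dd.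
  by move=> s; rewrite inE => /eqP->; exists k; rewrite -linearZ /= en res_d_aug.
- move=> z zS /res_kerS[w wz]; have [k az] := zS a (mem_head _ _).
  have [|n wn] := @res_ker0 _ _ E (a ^+ k *: w); first by rewrite linearZ /= wz.
  by exists k, n, w.
- move=> k n; have [|t [e [_ ee]]] := @res_div _ _ E R_noeth [::] 0%N a k (aug n).
    by [].
  by exists t, (d 0%N e), e; rewrite [(k + t)%N]addnC -ee linearZ.
move=> k n _ [e [<- en]]; split=> [[v vS dv]|[t [p np]]].
  have [j av] := vS a (mem_head _ _).
  have [|p pE] := @res_ker0 _ _ E (e - v); first by rewrite linearB /= dv subrr.
  exists j, p; apply: (@res_aug_inj R M E).
  rewrite !linearZ /= -en pE scalerBr (scale_pow0 k av) subr0 scalerA -exprD.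
  by rewrite addnC.
exists (e - aug p); last by rewrite linearB /= res_d_aug subr0.
move=> s; rewrite inE => /eqP->; exists (k + t)%N.
have /(congr1 aug) := np; rewrite !linearZ /= -en scalerA -exprD addnC => e1.
by rewrite scalerBr e1 subrr.
Qed.

(** H^2 is the cokernel of M_a + M_b -> M_ab, that is, of H^1_a(M) -> H^1_a(M)_b:
the cocycle z is d f with f an a-torsion cochain, and b ^ k f is a cocycle that
represents n / a ^ k in H^1_a(M). *)
Lemma presentation2 a b : a \in I -> b \in I ->
  (forall c, c \in I -> exists e r u, [/\ annihilator M r, ideal_gen [:: a; b] u & c ^+ e = r + u]) ->
  exists phi : nat -> M -> local_cohomology I E 2,
    presentation (a * b) (fun k n => exists p q, n = a ^+ k *: p + b ^+ k *: q) phi.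
Proof.
move=> aI bI S_rad; apply: (@presentation_of_relation I [:: a; b] 2%N (a * b) _
  (fun k n z => exists f e, [/\ d 1%N f = z, b ^+ k *: f = d 0%N e,
     a ^+ k *: e = aug n & exists l, a ^+ l *: f = 0])) => //.
- by move=> s; rewrite !inE => /orP[] /eqP->.
- by move=> k; exists 0, 0; rewrite !scaler0 addr0.
- move=> k _ [p [q ->]]; exists (b *: p), (a *: q).
  by rewrite scalerDr !scalerA !exprS; congr (_ *: _ + _ *: _); ring.
- move=> k r n _ n' _ [f [e [<- fe en [l al]]]] [f' [e' [<- fe' en' [l' al']]]].
  exists (r *: f + f'), (r *: e + e'); split.
  + by rewrite linearP.
  + by rewrite !linearP /= -fe -fe' !scalerA [r * _]mulrC.
  + by rewrite !linearP /= -en -en' !scalerA [r * _]mulrC.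
  exists (l + l')%N; rewrite scalerDr scalerA mulrC -scalerA (scale_pow0 l al').
  by rewrite addnC (scale_pow0 l' al) scaler0 addr0.
- move=> k n _ [f [e [<- fe en [l al]]]]; exists f, (b *: e); split=> //.
  + by rewrite exprS -scalerA fe linearZ.
  + by rewrite [RHS]linearZ /= -en !scalerA exprS; congr (_ *: _); ring.
  by exists l.
- move=> k n _ [f [e [<- fe en [l al]]]]; split; last exact: res_dd.
  move=> s; rewrite !inE => /orP[] /eqP->; first by exists l; rewrite -linearZ /= al linear0.
  by exists k; rewrite -linearZ /= fe res_dd.
- move=> z zS /res_kerS[w wz].
  (* Correct w by a coboundary to obtain an a-torsion cochain f with d f = z. *)
  have [k az] : exists n, a ^+ n *: z = 0 by apply: zS; rewrite mem_head.
  have [k' bz] : exists n, b ^+ n *: z = 0 by apply: zS; rewrite !inE eqxx orbT.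
  have [|u uw] := @res_kerS _ _ E 0%N (a ^+ k *: w); first by rewrite linearZ /= wz.
  have [|t [u' [_ uu']]] := @res_div _ _ E R_noeth [::] 0%N a k u; first by [].
  pose f := w - d 0%N u'.
  have af : a ^+ (t + k) *: f = 0.
    have /(congr1 (d 0%N)) := uu'; rewrite !linearZ /= uw scalerA -exprD => e1.
    by rewrite scalerBr e1 subrr.
  have df : d 1%N f = z by rewrite linearB res_dd subr0.
  have [|e ef] := @res_kerS _ _ E 0%N (b ^+ k' *: f); first by rewrite linearZ /= df.
  have [|n ne] := @res_ker0 _ _ E (a ^+ (t + k) *: e).
    by rewrite linearZ /= ef scalerA mulrC -scalerA af scaler0.
  exists (k' + (t + k))%N, ((a ^+ k' * b ^+ (t + k)) *: n), f, (b ^+ (t + k) *: e).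
  split=> //; last by exists (t + k)%N.
    by rewrite linearZ /= ef scalerA -exprD addnC.
  by rewrite [RHS]linearZ /= ne !scalerA exprD; congr (_ *: _); ring.
- move=> k n; have [|t [e [_ ee]]] := @res_div _ _ E R_noeth [::] 0%N a k (aug n).
    by [].
  have ade : a ^+ (t + k) *: d 0%N e = 0.
    by rewrite -linearZ /= -ee linearZ /= res_d_aug scaler0.
  have [|s [f [fS fe]]] := @res_div _ _ E R_noeth [:: a] 1%N b k (d 0%N e).
    by move=> c; rewrite inE => /eqP->; exists (t + k)%N.
  exists (s + t)%N, (d 1%N f), f, (b ^+ (s + t) *: e); split=> //.
  + have -> : (k + (s + t) = t + (s + k))%N by rewrite addnA addnC [(k + s)%N]addnC.
    by rewrite exprD -scalerA -fe [RHS]linearZ /= scalerA -exprD [(t + s)%N]addnC.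
  + rewrite [RHS]linearZ /=.
    have -> : (a * b) ^+ (s + t) = (b ^+ (s + t) * a ^+ s) * a ^+ t.
      by rewrite exprMn !exprD; ring.
    by rewrite -scalerA ee !scalerA; congr (_ *: _); rewrite !exprD; ring.
  by apply: fS; rewrite mem_head.
move=> k n _ [f [e [<- fe en [l al]]]]; split=> [[v vS dv]|[t [p [q npq]]]].
  have [i av] : exists n, a ^+ n *: v = 0 by apply: vS; rewrite mem_head.
  have [j bv] : exists n, b ^+ n *: v = 0 by apply: vS; rewrite !inE eqxx orbT.
  have [|u uE] := @res_kerS _ _ E 0%N (f - v); first by rewrite linearB /= dv subrr.
  have [|p pE] := @res_ker0 _ _ E (a ^+ (l + i) *: u).
    by rewrite linearZ /= uE scalerBr (scale_pow0 l av) addnC (scale_pow0 i al) subrr.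
  have [|q qE] := @res_ker0 _ _ E (b ^+ j *: e - b ^+ (j + k) *: u).
    rewrite linearB linearZ [X in _ - X]linearZ /= -fe uE scalerBr.
    by rewrite addnC (scale_pow0 k bv) subr0 scalerA -exprD addnC subrr.
  exists ((l + i) + j)%N, (b ^+ (l + i) *: q), (a ^+ (j + k) *: p).
  apply: (@res_aug_inj R M E).
  rewrite linearD [LHS]linearZ [X in X + _]linearZ [X in _ + X]linearZ /=.
  rewrite [X in _ *: X + _]linearZ [X in _ + _ *: X]linearZ /= -en qE pE.
  rewrite !(scalerBr, scalerA) -addrA -scaleNr -scalerDl.
  rewrite [X in _ + X](_ : _ = 0) ?addr0; last first.
    by rewrite -[RHS](scale0r u); congr (_ *: _); rewrite !exprD; ring.
  by congr (_ *: _); rewrite exprMn !exprD; ring.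
(* Conversely, n / (ab) ^ k = p / b ^ (k + t) + q / a ^ (k + t).  After removal of aug p
and of b ^ (k + t) u, where u is q / a ^ (k + t), what remains of b ^ t e is a-torsion,
hence equal to some b ^ (k + t) e2 with e2 a-torsion, up to b-power torsion; then
f - d u - d e2 is both a-torsion and b-torsion. *)
have [|s [u [_ uE]]] := @res_div _ _ E R_noeth [::] 0%N a (k + t) (aug q).
  by [].
have eE : a ^+ (k + t) *: (b ^+ t *: e - aug p) = b ^+ (k + t) *: aug q.
  have /(congr1 aug) := npq.
  rewrite linearD [LHS]linearZ [X in X + _]linearZ [X in _ + X]linearZ /= -en => E1.
  apply/eqP; rewrite scalerBr subr_eq addrC -E1 !scalerA; apply/eqP.
  by congr (_ *: _); rewrite exprMn !exprD; ring.
pose e1 := b ^+ t *: e - aug p - b ^+ (k + t) *: u.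
have ae1 : a ^+ (s + (k + t)) *: e1 = 0.
  rewrite scalerBr [X in X *: _ - _]exprD -[X in X - _]scalerA eE.
  rewrite scalerA mulrC -scalerA uE !scalerA.
  by rewrite [X in X *: _ - _]mulrC subrr.
have de1 : d 0%N e1 = b ^+ (k + t) *: (f - d 0%N u).
  rewrite linearB linearB res_d_aug subr0 linearZ [X in _ - X]linearZ /= -fe.
  by rewrite scalerBr scalerA -exprD [(t + k)%N]addnC.
have [|r [e2 [e2S ee2]]] := @res_div _ _ E R_noeth [:: a] 0%N b (k + t) e1.
  by move=> c; rewrite inE => /eqP->; exists (s + (k + t))%N.
have [i ae2] := e2S a (mem_head _ _).
exists (f - d 0%N u - d 0%N e2); last by rewrite !linearB !res_dd !subr0.
move=> c; rewrite !inE => /orP[] /eqP->; last first.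
  exists (r + (k + t))%N; have /(congr1 (d 0%N)) := ee2.
  rewrite !linearZ /= de1 scalerA -exprD => E2.
  by rewrite scalerBr E2 subrr.
have au : a ^+ (s + (k + t)) *: d 0%N u = 0.
  have /(congr1 (d 0%N)) := uE; rewrite !linearZ /= res_d_aug scaler0 => <- //.
set y := (s + (k + t))%N in au.
exists (l + (y + i))%N; rewrite !scalerBr.
have ae2' : a ^+ i *: d 0%N e2 = 0 by rewrite -linearZ /= ae2 linear0.
rewrite [X in X - _ - _](_ : _ = 0); last by rewrite addnC (scale_pow0 _ al).
rewrite [X in _ - X - _](_ : _ = 0); last first.
  by rewrite [(y + i)%N]addnC addnA (scale_pow0 _ au).
by rewrite addnA (scale_pow0 _ ae2') subr0 subrr.
Qed.

End Presentation.

(** * Finiteness and coregular parameters for the direct limits *)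

Section Limits.
Variables (R : comNzRingType) (m : idealr R) (M H : lmodType R).
Hypothesis R_local : local_ring m.
Hypothesis M_fg : finitely_generated M.
Local Notation max := (fun r => r \in m).
Local Notation Ann := (annihilator M).

Lemma presentation0_fine (phi : nat -> M -> H) e :
  presentation 1 (fun _ n => n = 0) phi -> pow_sub max Ann e ->
  fine_lt le_sub 1 (fun _ : submodClosed H => True).
Proof.
move=> [lin shift surj _] me.
have phi0 k n : phi k n = phi 0%N n.
  by elim: k => // k <-; rewrite -(shift k) scale1r.
apply: (@fine_strict _ _ _ _ (preimS (lin 0%N))) (@fine_above _ M _ R_local e (zero_submod M) M_fg _).
- exact: le_sub_pre.
- by move=> C _; split=> x => [|_]; [rewrite inE => /eqP->; apply: rpred0|exact: fullSP].
- split=> C C' _ _ CC'; first by move=> x /mkSP xC; apply/mkSP/CC'.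
  move=> pC h hC'; have [k [n hE]] := surj h.
  rewrite hE phi0; have /pC/mkSP // : n \in preimS (lin 0%N) C'.
  by apply/mkSP; rewrite -(phi0 k) -hE.
by move=> s x sz sm; rewrite inE; apply/eqP; apply: me.
Qed.

Section One.
Variables (a : R) (phi : nat -> M -> H).
Hypothesis phiP : presentation a (fun k n => exists p, n = a ^+ k *: p) phi.

(** The limit is unchanged when M is replaced by its quotient by a-power torsion, on
which multiplication by a is injective, so that M / (a M + torsion) has finite
length. *)
Lemma presentation1_fine e : pow_sub max (ideal_add (ideal_sat Ann a) a) e ->
  fine_lt le_sub 2 (fun _ : submodClosed H => True).
Proof.
move=> me; have [lin shift surj null] := phiP.
pose P (x : M) := exists p g : M, [/\ x = a *: p + g & exists t, a ^+ t *: g = 0].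
have PC : sub_closed P.
  split=> [|r _ _ [p [g [-> [s sg]]]] [q [g' [-> [t tg]]]]].
    by exists 0, 0; rewrite scaler0 addr0; split=> //; exists 0%N; rewrite scaler0.
  exists (r *: p + q), (r *: g + g'); split.
    by rewrite !scalerDr !scalerA mulrC addrACA.
  exists (s + t)%N; rewrite scalerDr (scale_pow0 s tg) addr0 addnC.
  by rewrite scalerA mulrC -scalerA (scale_pow0 t sg) scaler0.
apply: (@fine_strict _ _ _ _ id) (@fine_tower _ M H a phi (mkS PC) 1 lin _ shift _ _) => //.
- exact: le_sub_pre.
- by move=> q; apply/null; exists 0%N, q; rewrite !scale1r.
- move=> u /mkSP[p [g [-> [t tg]]]]; exists p, g; split=> // j.
  by apply/null; exists t, 0; rewrite tg scaler0.
apply: (fine_above (e := e) R_local M_fg) => s x sz sm; apply/mkSP.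
have [u [p [[t cu] ->]]] := me s sz sm.
exists (p *: x), (u *: x); split; last by exists t; rewrite scalerA cu.
by rewrite scalerDl addrC scalerA mulrC.
Qed.

(** H / x H is the limit for M / x M, on which a is nilpotent. *)
Lemma presentation1_surj x e : pow_sub max (ideal_add Ann x) e -> a \in m ->
  forall h : H, exists h', x *: h' = h.
Proof.
move=> me am h; have [lin shift surj null] := phiP.
have [k [n ->]] := surj h.
have [u [p [cu aE]]] := pow_sub1 me am.
have raise t w : phi (k + t)%N (a ^+ t *: w) = phi k w.
  elim: t => [|t IHt]; first by rewrite addn0 scale1r.
  by rewrite addnS exprS -scalerA shift.
exists (phi (k + e)%N (p *: n)).
by rewrite -(linZ (lin _)) scalerA mulrC -(raise e n) aE scalerDl cu add0r.
Qed.
End One.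

Section Two.
Variables (a b : R) (phi : nat -> M -> H).
Hypothesis phiP :
  presentation (a * b) (fun k n => exists p q, n = a ^+ k *: p + b ^+ k *: q) phi.

Let lin k : linear (phi k). Proof. by case: phiP. Qed.
Let shift k n : phi k.+1 ((a * b) *: n) = phi k n. Proof. by case: phiP. Qed.
Let null k n : phi k n = 0 <-> exists t p q,
  (a * b) ^+ t *: n = a ^+ (k + t) *: p + b ^+ (k + t) *: q.
Proof. by case: phiP => _ _ _; apply. Qed.

Let raise k t n : phi (k + t)%N ((a * b) ^+ t *: n) = phi k n.
Proof.
elim: t => [|t IHt]; first by rewrite addn0 scale1r.
by rewrite addnS exprS -scalerA shift.
Qed.

Let nulla k p : phi k (a ^+ k *: p) = 0.
Proof. by apply/null; exists 0%N, p, 0; rewrite scale1r scaler0 addr0 addn0. Qed.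

Let nullb k q : phi k (b ^+ k *: q) = 0.
Proof. by apply/null; exists 0%N, 0, q; rewrite scale1r scaler0 add0r addn0. Qed.

Lemma presentation2_tors (h : H) : exists n, a ^+ n *: h = 0.
Proof.
case: phiP => _ _ surj _; have [k [n ->]] := surj h.
by exists k; rewrite -(linZ (lin k)) nulla.
Qed.

(** The elements of H killed by a are the classes theta j q of the fractions
q / (a b ^ j); they form a quotient of the limit with respect to b of
M / (a M + a-power torsion), a module of dimension at most 1, to which the argument
for one element applies. Finally H is a-power torsion. *)
Lemma presentation2_fine e :
  pow_sub max (ideal_add (ideal_sat (ideal_add (ideal_sat Ann a) a) b) b) e ->
  fine_lt le_sub 3 (fun _ : submodClosed H => True).
Proof.
move=> me; apply: fine_torsion presentation2_tors _.
pose theta j q := phi j.+1 ((a ^+ j * b) *: q).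
have thetaE k p : phi k.+1 (a ^+ k *: p) = theta k.+1 p.
  rewrite -shift /theta scalerA; congr (phi _ (_ *: _)); rewrite exprS; ring.
have thetaS j q : theta j.+1 (b *: q) = theta j q.
  rewrite /theta -(shift j.+1) !scalerA; congr (phi _ (_ *: _)); rewrite exprS; ring.
have tlin j : linear (theta j).
  by move=> r x y; rewrite /theta scalerDr scalerA [_ * r]mulrC -[(r * _) *: x]scalerA; apply: lin.
have theta_raise j t q : theta (j + t)%N (b ^+ t *: q) = theta j q.
  elim: t => [|t IHt]; first by rewrite addn0 scale1r.
  by rewrite addnS exprS -scalerA thetaS.
have theta_a j q : theta j (a *: q) = 0.
  rewrite /theta scalerA (_ : a ^+ j * b * a = a ^+ j.+1 * b) -?scalerA ?nulla //.
  by rewrite exprS; ring.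
have theta_tors j g t : a ^+ t *: g = 0 -> theta j g = 0.
  move=> tg; apply/null; exists t, 0, 0; rewrite !scaler0 addr0 scalerA.
  rewrite (_ : (a * b) ^+ t * _ = b ^+ t * a ^+ j * b * a ^+ t); last by rewrite exprMn; ring.
  by rewrite -scalerA tg scaler0.
pose G (r : M) := exists t (p g : M), [/\ b ^+ t *: r = a *: p + g & exists s, a ^+ s *: g = 0].
have theta_G j r : G r -> theta j r = 0.
  move=> [t [p [g [rE [s sg]]]]].
  by rewrite -(theta_raise j t) rE (linD (tlin _)) theta_a (theta_tors _ _ _ sg) addr0.
have GC : sub_closed G.
  split=> [|r x y [t [p [g [xE [s sg]]]]] [t' [p' [g' [yE [s' sg']]]]]].
    by exists 0%N, 0, 0; rewrite !scaler0 addr0; split=> //; exists 0%N; rewrite scaler0.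
  exists (t + t')%N, ((b ^+ t' * r) *: p + b ^+ t *: p'), ((b ^+ t' * r) *: g + b ^+ t *: g').
  split; last first.
    exists (s + s')%N; rewrite scalerDr !scalerA ![a ^+ _ * _]mulrC -!scalerA.
    by rewrite (scale_pow0 s sg') addnC (scale_pow0 s' sg) !scaler0 addr0.
  have -> : b ^+ (t + t') *: (r *: x + y) = (b ^+ t' * r) *: (b ^+ t *: x) + b ^+ t *: (b ^+ t' *: y).
    by rewrite scalerDr !scalerA -exprD; congr (_ *: _ + _); rewrite exprD; ring.
  by rewrite xE yE !scalerDr !scalerA addrACA ![_ * a]mulrC.
pose P (x : M) := exists p g : M, x = b *: p + g /\ G g.
have PC : sub_closed P.
  split=> [|r _ _ [p [g [-> Gg]]] [q [g' [-> Gg']]]].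
    by exists 0, 0; rewrite scaler0 addr0; split=> //; case: GC.
  exists (r *: p + q), (r *: g + g'); split; last by case: GC => _; apply.
  by rewrite !scalerDr !scalerA mulrC addrACA.
apply: (@fine_strict _ _ _ _ id) (@fine_tower _ M H b theta (mkS PC) 1 tlin _ thetaS _ _) => //.
- exact: le_sub_pre.
- move=> C aC h /aC ah; case: phiP => _ _ surj _; have [k0 [n0 hE]] := surj h.
  move: ah; rewrite hE -(linZ (lin _)) => /null[t [p [q E]]].
  have [k [n [nE {}E]]] : exists k n, phi k0 n0 = phi k.+1 n /\
      exists p q, a *: n = a ^+ k.+1 *: p + b ^+ k.+1 *: q.
    exists (k0 + t)%N, ((a * b) ^+ t.+1 *: n0); split; first by rewrite -addnS raise.
    exists (b *: p), (a *: q).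
    have -> : a *: ((a * b) ^+ t.+1 *: n0) = (a * b) *: ((a * b) ^+ t *: (a *: n0)).
      by rewrite !scalerA exprS; congr (_ *: _); ring.
    by rewrite E scalerDr !scalerA !exprS; congr (_ *: _ + _ *: _); ring.
  have [p' [q' apq]] := E; exists k.+1, p'.
  rewrite nE -thetaE; apply/eqP; rewrite -subr_eq0 -(linB (lin _)) -shift; apply/eqP.
  rewrite mulrC -scalerA (_ : a *: _ = b ^+ k.+1 *: q'); last first.
    by rewrite scalerBr apq scalerA -exprS addrC addKr.
  by rewrite scalerA -exprS nullb.
- by move=> q; rewrite /theta expr0 mul1r -[b]expr1 nullb.
- by move=> u /mkSP[p [g [-> Gg]]]; exists p, g; split=> // j; apply: theta_G.
apply: (fine_above (e := e) R_local M_fg) => s x sz sm; apply/mkSP.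
have [u [p [[t [v [q [[l cv] uE]]]] ->]]] := me s sz sm.
exists (p *: x), (u *: x); split; first by rewrite scalerDl addrC scalerA mulrC.
exists t, (q *: x), (v *: x); split; last by exists l; rewrite scalerA cv.
by rewrite scalerA uE scalerDl addrC scalerA mulrC.
Qed.

(** The second local cohomology of a module of dimension at most 1 vanishes. *)
Lemma presentation2_low c k (u : M) : ideal c -> chains_lt max c 1 -> b \in m ->
  (forall r, c r -> r *: u = 0) -> phi k u = 0.
Proof.
move=> cI cd bm cu; case: (R_local) => R_noeth _ _.
have [T [r [v [cr E]]]] := chains_lt1_pow R_noeth a k cI cd bm.
apply/null; exists T, (v *: u), 0.
by rewrite E scalerDl cu // add0r scaler0 addr0 scalerA mulrC addnC.
Qed.

(** H / x H is the limit for M / x M, a module of dimension at most 1. *)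
Lemma presentation2_surj x : chains_lt max (ideal_add Ann x) 1 -> b \in m ->
  forall h : H, exists h', x *: h' = h.
Proof.
move=> xd bm h; case: phiP => _ _ surj _; have [k [n ->]] := surj h.
case: (R_local) => R_noeth _ _.
have [T [_ [v [[u [p [cu ->]]] E]]]] :=
  chains_lt1_pow R_noeth a k (ideal_add_ideal x (annihilator_ideal M)) xd bm.
exists (phi (k + T)%N (p *: n)); rewrite -(linZ (lin _)) -(raise k T n) E.
rewrite !scalerDl cu add0r (linD (lin _)) [v * _]mulrC -[(_ * v) *: n]scalerA addnC nulla addr0.
by rewrite scalerA mulrC.
Qed.

(** Up to modules of dimension at most 1, (0 :_H x) is a quotient of the first local
cohomology of M / x M, the homology of M_a + M_b -> M_ab modulo x: h = n / (ab) ^ k is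
killed by x when x n = a ^ k p + b ^ k q, and then corresponds to the cocycle
(p / b ^ k, q / a ^ k).  As M / (x, y) M is killed by powers of a and b, the cocycle is y
times a pair (b1 p / b ^ (k + e), a1 q / a ^ (k + e)) modulo x; the obstruction w to this
pair being a cocycle is killed by y modulo x, hence by a ^ e. *)
Lemma presentation2_surj2 x y e : chains_lt max (ideal_add Ann x) 1 ->
  pow_sub max (ideal_add (ideal_add Ann x) y) e -> a \in m -> b \in m ->
  forall h : H, x *: h = 0 -> exists2 h', x *: h' = 0 & y *: h' = h.
Proof.
move=> xd me am bm h xh; case: phiP => _ _ surj _; have [k0 [n0 hE]] := surj h.
have /null[t [p [q E]]] : phi k0 (x *: n0) = 0 by rewrite (linZ (lin _)) -hE.
have [k [n [{}hE {}E]]] : exists k n, h = phi k n /\ x *: n = a ^+ k *: p + b ^+ k *: q.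
  exists (k0 + t)%N, ((a * b) ^+ t *: n0); split; first by rewrite raise.
  by rewrite scalerA mulrC -scalerA E.
have split_pow z : z \in m -> exists y' x', forall w : M, z ^+ e *: w = y *: (y' *: w) + x *: (x' *: w).
  move=> zm; have [_ [y' [[u [x' [cu ->]]] ->]]] := pow_sub1 me zm.
  exists y', x' => w; rewrite !scalerDl cu add0r addrC !scalerA.
  by rewrite [y * _]mulrC [x * _]mulrC.
have [a1 [a2 aP]] := split_pow a am; have [b1 [b2 bP]] := split_pow b bm.
pose w := a ^+ (k + e) *: (b1 *: p) + b ^+ (k + e) *: (a1 *: q).
pose w2 := a ^+ (k + e) *: (b2 *: p) + b ^+ (k + e) *: (a2 *: q).
have yw : y *: w = x *: ((a * b) ^+ e *: n - w2).
  have E1 : x *: ((a * b) ^+ e *: n) = y *: w + x *: w2.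
    rewrite scalerA mulrC -scalerA E.
    have -> : (a * b) ^+ e *: (a ^+ k *: p + b ^+ k *: q) =
       a ^+ (k + e) *: (b ^+ e *: p) + b ^+ (k + e) *: (a ^+ e *: q).
      by rewrite scalerDr !scalerA exprMn !exprD; congr (_ *: _ + _ *: _); ring.
    rewrite aP bP !scalerDr !scalerA addrACA.
    by congr (_ *: _ + _ *: _ + (_ *: _ + _ *: _)); ring.
  by rewrite scalerBr E1 addrK.
have aw : a ^+ e *: w = x *: (a1 *: ((a * b) ^+ e *: n - w2) + a2 *: w).
  rewrite aP [y *: _]scalerA [y * a1]mulrC -scalerA yw [RHS]scalerDr.
  by rewrite [a1 *: (x *: _)]scalerA [a1 * x]mulrC -scalerA.
pose w' := a1 *: ((a * b) ^+ e *: n - w2) + a2 *: w.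
pose N := (a * b) ^+ e *: n.
pose err := b ^+ e *: (a ^+ e *: (N - w2) - y *: w').
(* The module killed by x has dimension at most 1, so err vanishes in the limit. *)
have xerr : x *: err = 0.
  rewrite /err scalerA mulrC -scalerA scalerBr scalerA mulrC -scalerA -yw.
  by rewrite [x *: (y *: _)]scalerA mulrC -scalerA -aw scalerA mulrC -scalerA subrr scaler0.
have ba : b ^+ e * a ^+ e = (a * b) ^+ e by rewrite -exprMn mulrC.
have errE : (a * b) ^+ e *: N = y *: (b ^+ e *: w') + ((a * b) ^+ e *: w2 + err).
  have cancel (u v z : M) : u = v + (z + (u - z - v)).
    by rewrite [u - z - v]addrAC [z + _]addrC subrK [v + _]addrC subrK.
  rewrite [LHS](cancel _ (y *: (b ^+ e *: w')) ((a * b) ^+ e *: w2)).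
  congr (_ + (_ + _)); rewrite /err [a ^+ e *: (N - w2)]scalerBr [RHS]scalerBr.
  by rewrite [b ^+ e *: (_ - _)]scalerBr !scalerA ba [b ^+ e * y]mulrC.
exists (phi (k + e + e)%N (b ^+ e *: w')).
  rewrite -(linZ (lin _)) scalerA mulrC -scalerA -aw scalerA -exprMn [b * a]mulrC.
  by rewrite raise /w (linD (lin _)) nulla nullb addr0.
have phiw2 : phi (k + e)%N w2 = 0 by rewrite /w2 (linD (lin _)) nulla nullb addr0.
rewrite hE -(raise k e n) -/N -(raise (k + e) e N) errE !(linD (lin _)) (linZ (lin _)).
rewrite raise phiw2 add0r.
rewrite (_ : phi (k + e + e)%N err = 0) ?addr0; first by rewrite !(linZ (lin _)).
apply: (@presentation2_low (ideal_add Ann x)) => //.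
  exact/ideal_add_ideal/annihilator_ideal.
by move=> r [u [v [cu ->]]]; rewrite scalerDl cu add0r -scalerA xerr scaler0.
Qed.

End Two.
End Limits.

(** * Coregular sequences on Artinian modules *)

Section Coregular.
Variables (R : comNzRingType) (m : idealr R) (H : lmodType R).
Hypothesis R_local : local_ring m.
Hypothesis H_dcc : dcc le_sub (fun _ : submodClosed H => True).
Implicit Types (Y Z N : submodClosed H) (x y z w : R).

Definition surj_on x Y : Prop := forall u, u \in Y -> exists2 v, v \in Y & x *: v = u.

Lemma killed_closed (s : seq R) : sub_closed (fun u : H => annihilated s u).
Proof.
split=> [|a u v us vs] y ys; first by rewrite scaler0.
by rewrite scalerDr scalerA mulrC -scalerA us // vs // scaler0 addr0.
Qed.
Definition killed s := mkS (killed_closed s).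

Lemma killed_rcons s x u : u \in killed (rcons s x) <-> u \in killed s /\ x *: u = 0.
Proof.
split=> [/mkSP us|[/mkSP us xu]].
  split; last by apply: us; rewrite mem_rcons mem_head.
  by apply/mkSP => y ys; apply: us; rewrite mem_rcons in_cons ys orbT.
by apply/mkSP => y; rewrite mem_rcons in_cons => /orP[/eqP->|/us].
Qed.

Lemma coregular_rcons s x : coregular m H (rcons s x) <->
  [/\ coregular m H s, x \in m & surj_on x (killed s)].
Proof.
split=> [[sm sP]|[[sm sP] xm xs]].
  split; first split=> [y ys|i si u us].
  - by apply: sm; rewrite mem_rcons in_cons ys orbT.
  - have tE : take i (rcons s x) = take i s by rewrite -cats1 takel_cat // ltnW.
    have := sP i; rewrite size_rcons ltnS tE nth_rcons si => /(_ (ltnW si) u us).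
    exact.
  - by apply: sm; rewrite mem_rcons mem_head.
  move=> u /mkSP us; have := sP (size s); rewrite size_rcons ltnSn nth_rcons ltnn eqxx.
  rewrite -cats1 take_size_cat // => /(_ isT u us)[v vs xv].
  by exists v => //; apply/mkSP.
split=> [y|i]; first by rewrite mem_rcons in_cons => /orP[/eqP->|/sm].
rewrite size_rcons ltnS leq_eqVlt => /orP[/eqP->|si] u.
  rewrite nth_rcons ltnn eqxx -cats1 take_size_cat // => us.
  by have [|v /mkSP vs xv] := xs u; [apply/mkSP|exists v].
by rewrite nth_rcons si -cats1 takel_cat ?(ltnW si) //; apply: sP.
Qed.

(** Iterating multiplication by x in m on an element of an Artinian module ends at
zero, by Nakayama's lemma for cyclic modules. *)
Lemma artinian_nilpotent x (u : H) : x \in m -> exists n, x ^+ n *: u = 0.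
Proof.
move=> xm; have [//|i|n nP] := H_dcc (c := fun i => lineS (x ^+ i *: u)).
  move=> v /mkSP[r ->]; apply/mkSP; exists (r * x).
  by rewrite exprS !scalerA mulrA.
have /mkSP[r E] : x ^+ n *: u \in lineS (x ^+ n.+1 *: u).
  by apply: (nP n.+1 (leqnSn n)); apply/mkSP; exists 1; rewrite scale1r.
have [y yE] : exists y, y * (1 - r * x) = 1.
  apply: (unit_outside_max R_local); apply/negP => rm.
  have := idealr1 m; rewrite -(subrK (r * x) 1) rpredD ?idealMr //.
exists n; rewrite -[x ^+ n *: u]scale1r -yE -scalerA scalerBl scale1r.
by rewrite {1}E exprS !scalerA mulrA subrr scaler0.
Qed.

Lemma killed_nonzero Y x : x \in m -> (exists2 u, u \in Y & u != 0) ->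
  exists2 u, u \in Y /\ x *: u = 0 & u != 0.
Proof.
move=> xm [u uY]; have [n] := artinian_nilpotent u xm.
elim: n u uY => [|n IHn] u uY; first by rewrite scale1r => ->; rewrite eqxx.
rewrite exprSr -scalerA; case: (eqVneq (x *: u) 0) => [xu _ u0|xu xnu _].
  by exists u.
by apply: (IHn (x *: u)) => //; apply: rpredZ.
Qed.

(** Along the ascending chain of the submodules (0 :_Y x ^ i), all subquotients are
isomorphic to (0 :_Y x), via multiplication by x ^ i. *)
Lemma dev_killed r Y Y' x : (forall u, u \in Y' <-> u \in Y /\ x *: u = 0) ->
  surj_on x Y -> dev_lt le_sub r.+1 (fun N => le_sub N Y) ->
  dev_lt le_sub r (fun N => le_sub N Y').
Proof.
move=> Y'P xY devY.
have surjX i : surj_on (x ^+ i) Y.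
  elim: i => [|i IHi] u uY; first by exists u; rewrite ?scale1r.
  have [v vY <-] := xY u uY; have [v' v'Y <-] := IHi v vY.
  by exists v'; rewrite // exprS scalerA.
have scale_lin i : linear (fun u : H => x ^+ i *: u).
  by move=> a u v; rewrite scalerDr !scalerA mulrC.
pose c i := capS Y (preimS (scale_lin i) (zero_submod H)).
have cP i u : u \in c i <-> u \in Y /\ x ^+ i *: u = 0.
  split=> [/mkSP[uY /mkSP]|[uY xu]]; first by rewrite inE => /eqP.
  by apply/mkSP; split=> //; apply/mkSP; rewrite inE xu.
have [i u /cP[]//|i u /cP[uY xu]|n nP] := devY c.
  by apply/cP; rewrite exprS -scalerA xu scaler0.
apply: (@dev_strict _ _ _ _ (fun N => capS Y (preimS (scale_lin n) N))) (nP n (leqnn n)).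
  move=> N NY; split=> u.
  - by move=> /mkSP[].
  - move=> /cP[uY xu]; apply/mkSP; split=> //; apply/mkSP; rewrite xu; exact: rpred0.
  - move=> /mkSP[uY /mkSP/NY/Y'P[_ xu]]; apply/cP; split=> //.
    by rewrite exprS -scalerA.
split=> A B AY BY AB; first by move=> u /mkSP[uY /mkSP uA]; apply/mkSP; split=> //; apply/mkSP/AB.
move=> BA u uB; have /Y'P[uY xu] := BY u uB; have [v vY vu] := surjX n u uY.
have /BA/mkSP[_ /mkSP] : v \in capS Y (preimS (scale_lin n) B).
  by apply/mkSP; split=> //; apply/mkSP; rewrite vu.
by rewrite vu.
Qed.

(** Each element of a coregular sequence lowers the deviation of the submodule killed
so far by at least one, and that submodule remains nonzero. *)
Lemma coregular_dev s : coregular m H s -> (exists u : H, u != 0) ->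
  ~ dev_lt le_sub (size s) (fun _ : submodClosed H => True).
Proof.
move=> cs [u0 u0N] dev_s.
suff K r : dev_lt le_sub (size s + r) (fun _ : submodClosed H => True) ->
    (exists2 u, u \in killed s & u != 0) /\ dev_lt le_sub r (fun N => le_sub N (killed s)).
  rewrite -[size s]addn0 in dev_s; have [[u us uN] dev0] := K 0%N dev_s.
  have le0 : le_sub (zero_submod H) (killed s).
    by move=> v; rewrite inE => /eqP->; apply: rpred0.
  have /(_ u us) : le_sub (killed s) (zero_submod H) by apply: dev0.
  by rewrite inE => /eqP u00; rewrite u00 eqxx in uN.
elim/last_ind: s cs r {dev_s} => [|s x IHs] cs r devr.
  split; first by exists u0 => //; apply/mkSP.
  by apply: dev_sub devr.
have [cs' xm xs] := (coregular_rcons s x).1 cs.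
have [|nz dev_s] := IHs cs' r.+1; first by rewrite addnS -addSn -(size_rcons s x).
split; last by apply: (dev_killed _ xs dev_s) => v; apply: killed_rcons.
have [u [us xu] uN] := killed_nonzero xm nz.
by exists u => //; apply/killed_rcons.
Qed.

(** Y = m Y, where m Y is seen as the smallest submodule Z that contains the products. *)
Definition m_idempotent Y : Prop := forall Z,
  (forall c u, c \in m -> u \in Y -> c *: u \in Z) -> le_sub Y Z.

(** If x and z act surjectively on H, then (0 : x) / m (0 : x) and
(0 : z) / m (0 : z) are isomorphic, by u |-> z v where u = x v: both are
Tor_1 (R / m, H). *)
Lemma exchange x z : x \in m -> (forall u : H, exists v, x *: v = u) ->
  (forall u : H, exists v, z *: v = u) ->
  m_idempotent (killed [:: x]) -> m_idempotent (killed [:: z]).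
Proof.
have k1 y u : u \in killed [:: y] <-> y *: u = 0.
  split=> [/mkSP|yu]; first by apply; rewrite mem_head.
  by apply/mkSP => y'; rewrite inE => /eqP->.
move=> xm xs zs xI Z ZP u /k1 zu.
have Z'C : sub_closed (fun t : H => exists w : H, z *: w = t /\ x *: w \in Z).
  split=> [|a _ _ [w [<- wZ]] [w' [<- wZ']]].
    by exists 0; rewrite !scaler0 rpred0.
  exists (a *: w + w'); rewrite !scalerDr !scalerA mulrC; split=> //.
  by rewrite [x * a]mulrC -scalerA submod_lin.
have [v xv] := xs u.
have Z'P : forall c t, c \in m -> t \in killed [:: x] -> c *: t \in mkS Z'C.
  move=> c t cm /k1 xt; have [w wt] := zs t; apply/mkSP; exists (c *: w).
  rewrite -wt !scalerA mulrC; split=> //; rewrite mulrC -scalerA; apply: ZP => //.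
  by apply/k1; rewrite scalerA mulrC -scalerA wt.
have /(xI _ Z'P)/mkSP[w [zw xw]] : z *: v \in killed [:: x].
  by apply/k1; rewrite scalerA mulrC -scalerA xv.
rewrite -xv -(subrK w v) scalerDr rpredD //; apply: ZP => //; apply/k1.
by rewrite scalerBr zw subrr.
Qed.

(** A weak form of secondary representation: up to a part killed by a power of m,
a submodule N of H is a sum of secondary submodules, on which all elements outside
of their attached primes act surjectively. *)
Definition decomposable N : Prop := exists (ps : seq (R -> Prop)) e N1,
  [/\ forall p, List.In p ps -> prime_ideal p /\ ~ (forall c, c \in m -> p c),
      le_sub N1 N,
      forall u, u \in N -> exists2 u1, u1 \in N1 & forall s : seq R, size s = e ->
        {subset s <= m} -> (\prod_(y <- s) y) *: (u - u1) = 0 &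
      forall w, w \in m -> (forall p, List.In p ps -> ~ p w) -> surj_on w N1].

Lemma decomposable_sum N A B : decomposable A -> decomposable B ->
  le_sub A N -> le_sub B N -> le_sub N (sumS A B) -> decomposable N.
Proof.
move=> [ps [e [A1 [psP AA ue sA]]]] [qs [f [B1 [qsP BB uf sB]]]] AN BN NS.
exists (ps ++ qs), (e + f)%N, (sumS A1 B1); split.
- by move=> p pin; case: (List.in_app_or _ _ _ pin) => [/psP|/qsP].
- by apply: sumS_min => u; [move=> /AA/AN|move=> /BB/BN].
- move=> _ /NS/mkSP[a [b [/ue[a1 a1A ea] /uf[b1 b1B fb] ->]]].
  exists (a1 + b1) => [|s sz sm]; first by apply/mkSP; exists a1, b1.
  have sT : {subset take e s <= m} by move=> y /mem_take/sm.
  have sD : {subset drop e s <= m} by move=> y /mem_drop/sm.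
  rewrite -(cat_take_drop e s) big_cat /= opprD addrACA scalerDr.
  rewrite -[X in _ + X]scalerA fb ?scaler0 ?addr0 ?size_drop ?sz ?addKn //.
  rewrite mulrC -scalerA ea ?scaler0 // size_takel // sz leq_addr //.
move=> w wm wP _ /mkSP[a [b [aA bB ->]]].
have [|a' a'A <-] := sA w wm _ a aA.
  by move=> p pps; apply: wP; apply: List.in_or_app; left.
have [|b' b'B <-] := sB w wm _ b bB.
  by move=> p pqs; apply: wP; apply: List.in_or_app; right.
by exists (a' + b'); rewrite ?scalerDr //; apply/mkSP; exists a', b'.
Qed.

Lemma scale_image_closed a N : sub_closed (fun v => exists2 u, u \in N & a *: u = v).
Proof.
split=> [|r _ _ [u uN <-] [v vN <-]]; first by exists 0; rewrite ?rpred0 ?scaler0.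
by exists (r *: u + v); [exact: submod_lin|rewrite scalerDr !scalerA mulrC].
Qed.
Definition scale_image a N := mkS (scale_image_closed a N).

(** Fitting's lemma.  The exponent is positive so that N = a ^ n.+1 N implies N = a N. *)
Lemma fitting_sum a N : exists n, le_sub N (sumS (scale_image (a ^+ n.+1) N)
  (capS N (killed [:: a ^+ n.+1]))).
Proof.
have [//|i|n nP] := H_dcc (c := fun i => scale_image (a ^+ i) N).
  move=> v /mkSP[u uN <-]; apply/mkSP; exists (a *: u); first exact: rpredZ.
  by rewrite scalerA -exprSr.
exists n => u uN.
have /mkSP[v vN vE] : a ^+ n.+1 *: u \in scale_image (a ^+ (n.+1 + n.+1)) N.
  apply: (nP (n.+1 + n.+1)%N (leq_trans (leqnSn n) (leq_addr _ _))).
  by apply/mkSP; exists (a *: u); rewrite ?rpredZ // scalerA -exprSr.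
apply/mkSP; exists (a ^+ n.+1 *: v), (u - a ^+ n.+1 *: v); split; last by rewrite addrC subrK.
  by apply/mkSP; exists v.
apply/mkSP; split; first by apply: submodB => //; apply: rpredZ.
apply/mkSP => y; rewrite inE => /eqP->.
by rewrite scalerBr scalerA -exprD vE subrr.
Qed.

Lemma pow_sum_in (J : R -> Prop) x y n k : ideal J -> J (x ^+ n) -> J (y ^+ k) ->
  J ((x + y) ^+ (n + k)).
Proof.
move=> JI Jx Jy.
suff [p [q ->]] : exists p q, (x + y) ^+ (n + k) = p * x ^+ n + q * y ^+ k.
  by apply: idealD => //; apply: idealM.
elim: n k {Jx Jy} => [|n IHn] k.
  by exists ((x + y) ^+ k), 0; rewrite mul0r addr0 mulr1.
elim: k => [|k [p [q E]]].
  by exists 0, ((x + y) ^+ n.+1); rewrite mul0r add0r mulr1 addn0.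
have [p' [q' E']] := IHn k.+1.
exists (p' + y * p), (x * q' + q).
have -> : (x + y) ^+ (n.+1 + k.+1) = x * (x + y) ^+ (n + k.+1) + y * (x + y) ^+ (n.+1 + k).
  by rewrite !addSnnS -mulrDl -exprS addnS.
by rewrite E E' !exprS; ring.
Qed.

(** A minimal counterexample A is not the sum of two proper submodules, so by Fitting's
lemma every element of R is nilpotent or surjective on A.  The nilpotent ones form a
prime ideal P; either P contains m, and a power of m kills A, or P alone decomposes A. *)
Lemma decomposable_all N : decomposable N.
Proof.
apply: contrapT => ND.
have [|A [AD Amin]] := @maximal_exists _ (fun A B => le_sub B A /\ ~ le_sub A B)
    (fun A => ~ decomposable A) N _ ND.
  move=> c _ cS; have [//|i|n nP] := H_dcc (c := c); first by case: (cS i).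
  by case: (cS n) => _; apply; apply: nP.
have Asub B : le_sub B A -> ~ le_sub A B -> decomposable B.
  by move=> BA AB; apply: contrapT => BD; apply: (Amin B).
have zeroD e : (forall u, u \in A -> forall s : seq R, size s = e ->
    {subset s <= m} -> (\prod_(y <- s) y) *: u = 0) -> False.
  move=> eA; apply: AD; exists [::], e, (zero_submod H); split=> //.
  - by move=> u; rewrite inE => /eqP->; apply: rpred0.
  - move=> u uA; exists 0; rewrite ?rpred0 // => s sz sm; rewrite subr0; exact: eA.
  - by move=> w _ _ u; rewrite inE => /eqP->; exists 0; rewrite ?rpred0 ?scaler0.
pose P a := exists n, forall u, u \in A -> a ^+ n *: u = 0.
have dich a : P a \/ surj_on a A.
  have [n nP] := fitting_sum a A.
  have iA : le_sub (scale_image (a ^+ n.+1) A) A.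
    by move=> v /mkSP[u uA <-]; apply: rpredZ.
  case: (pselect (le_sub A (scale_image (a ^+ n.+1) A))) => [Ai|iN].
    right=> u /Ai/mkSP[v vA <-]; exists (a ^+ n *: v); first exact: rpredZ.
    by rewrite scalerA exprS.
  case: (pselect (le_sub A (killed [:: a ^+ n.+1]))) => [Ak|kN].
    left; exists n.+1 => u /Ak/mkSP; apply; exact: mem_head.
  have cA : le_sub (capS A (killed [:: a ^+ n.+1])) A by move=> u /mkSP[].
  case: AD; apply: (decomposable_sum _ _ iA cA nP); first exact: Asub.
  by apply: Asub => // Ac; apply: kN => u /Ac/mkSP[].
have A0 : ~ forall u, u \in A -> u = 0.
  by move=> A0; apply: (zeroD 0%N) => u /A0-> s _ _; rewrite scaler0.
have surjX a n : surj_on a A -> surj_on (a ^+ n) A.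
  move=> aA; elim: n => [|n IHn] u uA; first by exists u; rewrite ?scale1r.
  have [v vA <-] := aA u uA; have [v' v'A <-] := IHn v vA.
  by exists v'; rewrite // exprS scalerA.
have PN a : P a -> ~ surj_on a A.
  by move=> [n nA] /(surjX _ n) aA; apply: A0 => u /aA[v /nA -> <-].
have PP : prime_ideal P.
  split.
  - split=> [|r a b [n nA] [k kA]]; first by exists 1%N => u _; rewrite scale0r.
    exists (n + k)%N => u uA.
    apply: (@pow_sum_in (fun c => c *: u = 0)).
    + split=> [|c x y xu yu]; first by rewrite scale0r.
      by rewrite scalerDl -scalerA xu yu scaler0 addr0.
    + by rewrite exprMn -scalerA nA // scaler0.
    + exact: kA.
  - by move=> /PN; apply => u uA; exists u; rewrite ?scale1r.
  move=> a b; case: (dich a) => [|aA]; [by left|]; case: (dich b) => [|bA]; [by right|].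
  move=> /PN; case=> u /aA[v /bA[w wA <-] <-]; exists w => //; by rewrite scalerA.
case: (pselect (forall c, c \in m -> P c)) => [mP|mP].
  case: (R_local) => R_noeth _ _; have [l [g [gm gP]]] := R_noeth m.
  have /choice[n nP] c : exists n, c \in m -> forall u, u \in A -> c ^+ n *: u = 0.
    by case: (boolP (c \in m)) => [/mP[n]|_]; [exists n|exists 0%N].
  have [e eP] := tors_pow_exp H (codom g) n.
  apply: (zeroD e) => u uA s sz sm; apply: eP => //.
    by move=> _ /codomP[i ->]; apply: nP.
  move=> y /sm/gP[f ->]; apply: ideal_gen_sum => i; exact: codom_f.
apply: AD; exists [:: P], 0%N, A; split=> //.
- by move=> p [<-|].
- by move=> u uA; exists u => // s _ _; rewrite subrr scaler0.
by move=> w _ wP; case: (dich w) => // Pw; case: (wP P); [left|].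
Qed.

(** Since Y = m ^ e Y, the part of Y killed by m ^ e can be dropped, so an element of m
outside of the attached primes acts surjectively.  This is dual to the existence of a
regular element when no associated prime contains m. *)
Lemma surj_exists Y : m_idempotent Y -> exists2 w, w \in m & surj_on w Y.
Proof.
move=> YI; have [ps [e [N1 [psP N1Y Ye N1s]]]] := decomposable_all Y.
suff YN : le_sub Y N1.
  have [w wm wps] := prime_avoidance (idealr_ideal m) psP.
  by exists w => // u /YN/(N1s w wm wps)[v /N1Y vY <-]; exists v.
have QC j : sub_closed (fun u : H => forall s : seq R, size s = j ->
    {subset s <= m} -> (\prod_(y <- s) y) *: u \in N1).
  split=> [|a u v uQ vQ] s sz sm; first by rewrite scaler0 rpred0.
  by rewrite scalerDr scalerA mulrC -scalerA submod_lin ?uQ ?vQ.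
suff Y0 : le_sub Y (mkS (QC 0%N)).
  move=> u /Y0/mkSP/(_ [::] (erefl _)); rewrite big_nil scale1r; apply.
  by move=> x.
have Qe : le_sub Y (mkS (QC e)).
  move=> u /Ye[u1 u1N eu]; apply/mkSP => s sz sm.
  by rewrite -(subrK u1 u) scalerDr eu // add0r rpredZ.
have step i : le_sub Y (mkS (QC i.+1)) -> le_sub Y (mkS (QC i)).
  move=> Yi; apply: YI => c u cm /Yi/mkSP uQ; apply/mkSP => s sz sm.
  rewrite scalerA mulrC -(big_cons 1 *%R c s xpredT id) uQ //= ?sz //.
  by move=> y; rewrite in_cons => /orP[/eqP->|/sm].
by elim: e Qe {N1s Ye} => // i IHi /step.
Qed.

End Coregular.

(** * Dimension at most two *)

Section CoCohenMacaulayCriterion.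
Variables (R : comNzRingType) (m : idealr R) (H : lmodType R).
Hypothesis R_local : local_ring m.
Hypothesis H_nonzero : ~ is_zero_module H.

Lemma killed_nil u : u \in killed H [::].
Proof. exact/mkSP. Qed.

Lemma coregular_nil : coregular m H [::].
Proof. by split. Qed.

(** It suffices to extend short coregular sequences: N.dim H bounds the length of
all coregular sequences, and one of length N.dim H exists. *)
Lemma co_Cohen_Macaulay_criterion d :
  fine_lt le_sub d.+1 (fun _ : submodClosed H => True) ->
  (forall s, coregular m H s -> (size s < d)%N -> exists x, coregular m H (rcons s x)) ->
  co_Cohen_Macaulay m H.
Proof.
move=> [H_dcc H_dev] ext.
have nz : exists u : H, u != 0.
  apply: contrapT => H0; apply: H_nonzero => u; apply/eqP; apply: contrapT => /negP u0.
  by apply: H0; exists u.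
have bound s : coregular m H s -> (size s <= d)%N.
  move=> cs; rewrite leqNgt; apply/negP => ds.
  apply: (coregular_dev R_local H_dcc cs nz).
  by rewrite -(subnK ds); elim: (size s - d.+1)%N => // i; apply: dev_ltW.
have [s cs sz] : exists2 s, coregular m H s & size s = d.
  have: forall i, (i <= d)%N -> exists2 s, coregular m H s & size s = i.
    elim=> [_|i IHi id]; first by exists [::] => //; apply: coregular_nil.
    have [s cs sz] := IHi (ltnW id); have [|x cx] := ext s cs; first by rewrite sz.
    by exists (rcons s x); rewrite ?size_rcons ?sz.
  exact.
split; first exact: artinianE.
exists d; split; last first.
  apply/Ndim_eqE; split=> //.
  by rewrite -sz; exact: (coregular_dev R_local H_dcc cs nz).
split=> [|t [ct tmax]].
  exists s; split=> // x /bound; by rewrite size_rcons sz ltnn.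
apply/eqP; rewrite eqn_leq bound //= leqNgt; apply/negP => /(ext t ct)[x].
exact: tmax.
Qed.

Lemma coregular_extend s x : coregular m H s -> x \in m -> surj_on x (killed H s) ->
  coregular m H (rcons s x).
Proof. by move=> cs xm xs; apply/coregular_rcons. Qed.

End CoCohenMacaulayCriterion.

Lemma m_idempotent_surj (R : comNzRingType) (m : idealr R) (H : lmodType R) y
    (Y : submodClosed H) : y \in m -> surj_on y Y -> m_idempotent m Y.
Proof. by move=> ym yY Z ZP u /yY[v vY <-]; apply: ZP. Qed.

Section Main.
Variables (R : comNzRingType) (m : idealr R) (M : lmodType R) (I : idealr R).
Variable E : injective_resolution M.
Hypothesis R_local : local_ring m.
Hypothesis M_fg : finitely_generated M.
Local Notation max := (fun r => r \in m).
Local Notation Ann := (annihilator M).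

Let R_noeth : noetherian_ring R. Proof. by case: R_local. Qed.
Let AnnI : ideal Ann := annihilator_ideal M.
Let max_ideal : ideal max := idealr_ideal m.
Let I_ideal : ideal (fun r => r \in I) := idealr_ideal I.

Lemma killed1P (H : lmodType R) x (u : H) : u \in killed H [:: x] <-> x *: u = 0.
Proof.
split=> [/mkSP|xu]; first by apply; rewrite mem_head.
by apply/mkSP => y; rewrite inE => /eqP->.
Qed.

Lemma co_Cohen_Macaulay0 : krull_dim M 0 ->
  ~ is_zero_module (local_cohomology I E 0) ->
  co_Cohen_Macaulay m (local_cohomology I E 0).
Proof.
move=> Md Hnz.
have [e eP] := chains_lt0 R_noeth AnnI (krull_dim_chains_lt R_local (J := m) Md).
have [f fP] := chains_lt0 R_noeth AnnI (krull_dim_chains_lt R_local (J := I) Md).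
have [c cI|phi phiP] := @presentation0 R M E R_noeth I.
  exists f, (c ^+ f), 0; rewrite addr0; split=> //; first exact: pow_sub1 fP cI.
  by case: (ideal_gen_ideal (R := R) [::]).
apply: (co_Cohen_Macaulay_criterion R_local Hnz (d := 0)) => //.
exact: (presentation0_fine R_local M_fg phiP eP).
Qed.

Lemma co_Cohen_Macaulay1 : krull_dim M 1 ->
  ~ is_zero_module (local_cohomology I E 1) ->
  co_Cohen_Macaulay m (local_cohomology I E 1).
Proof.
move=> Md Hnz.
have dm := krull_dim_chains_lt R_local (J := m) Md.
have [x xm dx] := chains_lt_avoid R_noeth max_ideal AnnI dm.
have [e eP] := chains_lt0 R_noeth (ideal_add_ideal x AnnI) dx.
have [a aI da] := chains_lt_avoid R_noeth I_ideal AnnI (krull_dim_chains_lt R_local (J := I) Md).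
have [f fP] := chains_lt0 R_noeth (ideal_add_ideal a AnnI) da.
have am := idealr_sub_max R_local aI.
have [c cI|phi phiP] := @presentation1 R M E R_noeth I a aI.
  have [u [p [uA cE]]] := pow_sub1 fP cI.
  exists f, u, (p * a); split=> //.
  by apply: idealM (ideal_gen_ideal _) _; apply: ideal_gen_mem; rewrite mem_head.
have satI := ideal_add_ideal a (ideal_sat_ideal a AnnI).
have [g gP] := chains_lt0 R_noeth satI (chains_lt_sat R_noeth (a := a) AnnI dm).
apply: (co_Cohen_Macaulay_criterion R_local Hnz (d := 1)).
  exact: (presentation1_fine R_local M_fg phiP gP).
case=> [cs _|//]; exists x; apply: coregular_extend => // u _.
have [v xv] := presentation1_surj phiP eP am u.
by exists v => //; apply: killed_nil.
Qed.

(** The parameters x, y form a coregular sequence.  For another coregular element z,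
(0 : z) = m (0 : z) follows by exchange with x, so z can be completed as well. *)
Lemma co_Cohen_Macaulay2 : krull_dim M 2 ->
  ~ is_zero_module (local_cohomology I E 2) ->
  co_Cohen_Macaulay m (local_cohomology I E 2).
Proof.
move=> Md Hnz.
have dm := krull_dim_chains_lt R_local (J := m) Md.
have [x xm dx] := chains_lt_avoid R_noeth max_ideal AnnI dm.
have AnnxI := ideal_add_ideal x AnnI.
have [y ym dy] := chains_lt_avoid R_noeth max_ideal AnnxI dx.
have [e eP] := chains_lt0 R_noeth (ideal_add_ideal y AnnxI) dy.
have [a aI da] := chains_lt_avoid R_noeth I_ideal AnnI (krull_dim_chains_lt R_local (J := I) Md).
have AnnaI := ideal_add_ideal a AnnI.
have [b bI db] := chains_lt_avoid R_noeth I_ideal AnnaI da.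
have [f fP] := chains_lt0 R_noeth (ideal_add_ideal b AnnaI) db.
have am := idealr_sub_max R_local aI; have bm := idealr_sub_max R_local bI.
have [c cI|phi phiP] := @presentation2 R M E R_noeth I a b aI bI.
  have [_ [q [[u [p [uA ->]]] cE]]] := pow_sub1 fP cI.
  have genI := ideal_gen_ideal [:: a; b].
  exists f, u, (p * a + q * b); rewrite addrA; split=> //.
  by apply: idealD => //; apply: idealM => //; apply: ideal_gen_mem; rewrite !inE eqxx ?orbT.
have satI := ideal_add_ideal a (ideal_sat_ideal a AnnI).
have dsat := chains_lt_sat R_noeth (a := a) AnnI dm.
have sat2I := ideal_add_ideal b (ideal_sat_ideal b satI).
have [g gP] := chains_lt0 R_noeth sat2I (chains_lt_sat R_noeth (a := b) satI dsat).
have H_fine := presentation2_fine R_local M_fg phiP gP.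
have xs := presentation2_surj R_local phiP dx bm.
apply: (co_Cohen_Macaulay_criterion R_local Hnz H_fine).
have xI : m_idempotent m (killed (local_cohomology I E 2) [:: x]).
  apply: (m_idempotent_surj (y := y)) => // u /killed1P xu.
  have [v xv yv] := presentation2_surj2 R_local phiP dx eP am bm xu.
  by exists v => //; apply/killed1P.
case=> [|z [|//]] cs _.
  exists x; apply: coregular_extend => // u _; have [v xv] := xs u.
  by exists v => //; apply: killed_nil.
have [_ zm zs] := (coregular_rcons m _ [::] z).1 cs.
have [|w wm ws] := @surj_exists _ m _ R_local H_fine.1 (killed (local_cohomology I E 2) [:: z]).
  apply: exchange xm xs _ xI => u.
  by have [|v _ zv] := zs u; [apply: killed_nil|exists v].
by exists w; apply: coregular_extend.
Qed.

End Main.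

Theorem corollary2p5 (R : comNzRingType) (m : idealr R) (hR : local_ring m)
  (M : lmodType R) (hM : finitely_generated M) (d : nat) (hd : krull_dim M d)
  (I : idealr R) (E : injective_resolution M)
  (hH : ~ is_zero_module (local_cohomology I E d)) (hd2 : (d <= 2)%N) :
  co_Cohen_Macaulay m (local_cohomology I E d).
Proof.
case: d hd hH hd2 => [|[|[|//]]] hd hH _.
- exact: co_Cohen_Macaulay0.
- exact: co_Cohen_Macaulay1.
- exact: co_Cohen_Macaulay2.
Qed.
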